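(* Let $(X_n)_{n\in\mathbb{N}}$ be a random sequence in $\mathbb{R}^d$, adapted to a filtration $(\mathcal{F}_n)_{n\in\mathbb{N}}$, such that for all $n\ge0$ $$X_{n+1}-X_n=\gamma_{n+1}G_n+c_{n+1}(\varepsilon_{n+1}+r_{n+1}),$$ with $\gamma,c,G,\varepsilon,r$ as in the context. Let $\Gamma$ be an event. For each $n\ge0$, let $H_n$ be an $\mathcal{F}_n$-measurable $\mathcal{M}_d(\mathbb{R})$-valued random matrix. Let $H\in\mathcal{M}_d(\mathbb{R})$ be a repulsive matrix, i.e. all its eigenvalues have a positive real part. Suppose that there are $a>2$ and a finite random variable $T_0$ such that, almost surely on $\Gamma$, \begin{itemize} \item $G_n=H_nX_n$ for all $n\ge T_0$; \item $\lim_{n\to\infty}H_n=H$; \item $0<\liminf_{n\to\infty}\mathbb{E}[\|\varepsilon_n\|^2|\mathcal{F}_{n-1}]$, $\ \limsup_{n\to\infty}\mathbb{E}[\|\varepsilon_n\|^a|\mathcal{F}_{n-1}]<\infty$, and $\sum_n\|r_n\|^2<\infty$. \end{itemize} Then $\mathbb{P}\big[\Gamma\cap\{\lim_{n\to\infty}X_n=0\}\big]=0$.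
   Context: $\mathcal{M}_d(\mathbb{R})$ is the set of real $d\times d$ matrices and $\|\cdot\|$ is the norm of an inner product on $\mathbb{R}^d$. $(\gamma_n)_{n\ge0}$ and $(c_n)_{n\ge0}$ are non-negative deterministic sequences with $c_n\ne0$ infinitely often and $\sum_nc_n^2<\infty$. $(\varepsilon_n)_{n\ge0}$, $(r_n)_{n\ge0}$ and $(G_n)_{n\ge0}$ are $\mathbb{R}^d$-valued sequences adapted to $(\mathcal{F}_n)$ such that for all $n\ge0$, $\mathbb{E}[\varepsilon_{n+1}|\mathcal{F}_n]=0$ and $\mathbb{E}[\|\varepsilon_{n+1}\|^2|\mathcal{F}_n]<\infty$. *)

(* Defs.v *)
From mathcomp Require Export all_boot all_order all_algebra.
From mathcomp Require Export complex.
From mathcomp Require Export all_classical all_reals all_analysis.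
From mathcomp Require Export measurable_realfun.

Set Implicit Arguments.
Unset Strict Implicit.
Unset Printing Implicit Defensive.

Export Order.TTheory GRing.Theory Num.Theory.
Export numFieldNormedType.Exports.

Local Open Scope classical_set_scope.
Local Open Scope ring_scope.

Definition dot_norm (R : realType) (d : nat)
    (dot : {dot 'cV[R]_d for idfun}) (x : 'cV[R]_d) : R :=
  Num.sqrt (dot x x).

(* [eigenvalue] ranges over the base field, hence the passage to R[i]. *)
Definition repulsive (R : realType) (d : nat) (H : 'M[R]_d) : Prop :=
  forall z : R[i], eigenvalue (map_mx (real_complex R) H) z ->
    0 < complex.Re z.

Definition filtration (disp : measure_display) (T : measurableType disp)
    (F : nat -> set (set T)) : Prop :=
  [/\ forall n, sigma_algebra setT (F n),
      forall n, F n `<=` measurable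
    & forall m n, (m <= n)%N -> F m `<=` F n].

(* [measurable_fun] from the measurable space (T, G), G being a sigma-algebra
   on T in all uses. *)
Definition measurable_wrt (disp disp' : measure_display)
    (T : measurableType disp) (U : measurableType disp')
    (G : set (set T)) (f : T -> U) : Prop :=
  measurable_fun [set: g_sigma_algebraType G] (f : g_sigma_algebraType G -> U).

(* There is no measurable structure on matrices in the library; the Borel
   sigma-algebra of R^(m x n) is the product one, so measurability is
   entrywise. *)
Definition mx_measurable_wrt (disp : measure_display)
    (T : measurableType disp) (R : realType) (m n : nat)
    (G : set (set T)) (f : T -> 'M[R]_(m, n)) : Prop :=
  forall i j, measurable_wrt G (fun w => f w i j).

Definition adapted (disp : measure_display) (T : measurableType disp)
    (R : realType) (m n : nat) (F : nat -> set (set T))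
    (Y : nat -> T -> 'M[R]_(m, n)) : Prop :=
  forall k, mx_measurable_wrt (F k) (Y k).

(* g is a version of E[f | G], for f nonnegative; f need not be integrable and
   g may take the value +oo. *)
Definition is_condexp_ge0 (disp : measure_display) (T : measurableType disp)
    (R : realType) (P : probability T R) (G : set (set T))
    (f g : T -> \bar R) : Prop :=
  [/\ measurable_wrt G g, forall w, (0 <= g w)%E
    & forall A, G A -> (\int[P]_(w in A) g w = \int[P]_(w in A) f w)%E].

(* g is a version of E[f | G] := E[f^+ | G] - E[f^- | G], where E[f^+ | G] and
   E[f^- | G] are almost surely finite. For f integrable this is the usual
   conditional expectation; f is not required to be integrable because
   E[f^2 | G] < +oo almost surely does not imply it. *)
Definition is_condexp (disp : measure_display) (T : measurableType disp)
    (R : realType) (P : probability T R) (G : set (set T))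
    (f g : T -> R) : Prop :=
  measurable_wrt G g /\
  exists u v : T -> \bar R,
    [/\ is_condexp_ge0 P G ((EFin \o f)^\+)%E u,
        is_condexp_ge0 P G ((EFin \o f)^\-)%E v
      & {ae P, forall w, [/\ u w \is a fin_num, v w \is a fin_num
                           & (g w)%:E = (u w - v w)%E]}].

Definition mx_is_condexp (disp : measure_display) (T : measurableType disp)
    (R : realType) (P : probability T R) (m n : nat) (G : set (set T))
    (f g : T -> 'M[R]_(m, n)) : Prop :=
  forall i j, is_condexp P G (fun w => f w i j) (fun w => g w i j).

(* Main.v *)
Require Import Defs.
From mathcomp Require Import spectral mxred.
From mathcomp Require Import ring lra.

Set Implicit Arguments.
Unset Strict Implicit.
Unset Printing Implicit Defensive.

Local Open Scope classical_set_scope.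
Local Open Scope ring_scope.

(* A Schur triangularization of [H] over the complex numbers, followed by a
   diagonal rescaling, yields an injective real matrix [B] such that [H] pushes
   outwards for the Euclidean norm of [B x].  Hence, almost surely on [Gamma],
   |B X_n| <= |B (X_n + gam_(n+1) G_n)| for large [n], however large [gam] is;
   this is all that is used of [G], [H_n] and [H].

   If [X_n] tended to [0] with positive probability on [Gamma], so it would on
   an event [E] on which the remaining conditions hold with fixed constants
   from a fixed rank on.  [E] is a limit of events of the [F_n], so for large
   [n] there is [A] in [F_n] with P(A \ E) <= eta P(A).  Let s^2 be the sum of
   the [c_k^2] for [k > n], and let [phi] be a bounded, Lipschitz, radially
   nondecreasing function which is uniformly convex near [0] in all directions
   while its Hessian is everywhere bounded below by a small negative constant.
   As the noise is centered, E[phi(X_k / s)] grows on [A], up to small errors: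
   either X_k / s mostly stays in the unit ball, where convexity and the lower
   bound on the noise give a gain of order 1 in total, or it leaves the ball
   once with probability of order P(A), and then the gain has already been
   made.  In both cases E[phi(X_k / s); A] stays above a constant multiple of
   P(A), whereas on [E] it tends to [0]. *)

(** * The bounded potential *)

(** The obstacle is that [gam] is arbitrary: a single drift may be huge, so it cannot be expanded,
    and X_n need not be integrable. Only the radial monotonicity of phi is used against the drift,
    and phi is bounded because nothing is known on A \ E: losing this event then costs a multiple of
    M P(A \ E), where M bounds phi. A nonconstant bounded function is not convex, so some concavity
    must be paid for; capping at height M costs at most C / (4 M) per unit of probability over the
    whole future, because the c_k^2 / s^2 add up to 1. The Lipschitz property disposes of the
    remainders, whose total effect, the sum of c_k |r_k| / s, is controlled by the l^2 norm of r.
    The exponent a > 2 keeps the variance from being carried by rare huge jumps, for which convexity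
    near 0 gains nothing: a fixed part of the variance survives truncation at a level K. The
    constants are fixed in the order b, C, K, then M, then eta with n0 and A, then s, and last the
    time at which the two estimates are compared. *)

Section euclidean.
Context {R : realType} {m : nat}.
Implicit Types x y z : 'cV[R]_m.

Definition edot x y : R := \sum_i x i 0 * y i 0.

Definition enorm x : R := Num.sqrt (edot x x).

Lemma edotC x y : edot x y = edot y x.
Proof. by apply: eq_bigr => i _; rewrite mulrC. Qed.

Lemma edotDl x y z : edot (x + y) z = edot x z + edot y z.
Proof. by rewrite /edot -big_split; apply: eq_bigr => i _;
  rewrite mxE mulrDl. Qed.

Lemma edotZl t x y : edot (t *: x) y = t * edot x y.
Proof. by rewrite /edot mulr_sumr; apply: eq_bigr => i _;
  rewrite mxE mulrA. Qed.

Lemma edotDr x y z : edot x (y + z) = edot x y + edot x z.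
Proof. by rewrite !(edotC x) edotDl. Qed.

Lemma edotZr t x y : edot x (t *: y) = t * edot x y.
Proof. by rewrite !(edotC x) edotZl. Qed.

Lemma edot_ge0 x : 0 <= edot x x.
Proof. by apply: sumr_ge0 => i _; rewrite -expr2 sqr_ge0. Qed.

Lemma sqr_enorm x : enorm x ^+ 2 = edot x x.
Proof. by rewrite sqr_sqrtr ?edot_ge0. Qed.

Lemma enorm_ge0 x : 0 <= enorm x.
Proof. exact: sqrtr_ge0. Qed.

Lemma enormZ t x : enorm (t *: x) = `|t| * enorm x.
Proof.
by rewrite /enorm edotZl edotZr mulrA -expr2 sqrtrM ?sqr_ge0// sqrtr_sqr.
Qed.

Lemma le_enorm x y : (enorm x <= enorm y) = (edot x x <= edot y y).
Proof. by rewrite ler_sqrt ?edot_ge0. Qed.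

Lemma coord_le_enorm x i : `|x i 0| <= enorm x.
Proof.
rewrite -sqrtr_sqr ler_sqrt ?edot_ge0// /edot (bigD1 i)//= expr2 lerDl.
by apply: sumr_ge0 => j _; rewrite -expr2 sqr_ge0.
Qed.

End euclidean.

Section cauchy_schwarz.
Context {R : realType} {V : lmodType R} (f : V -> V -> R).
Hypotheses (fC : forall x y, f x y = f y x)
  (fD : forall x y z, f (x + y) z = f x z + f y z)
  (fZ : forall t x y, f (t *: x) y = t * f x y) (f_ge0 : forall x, 0 <= f x x).

(** Stated for an abstract semidefinite form so that it serves both [edot] and [dot]. The usual
    choice of coefficients, [f y y] and [- f x y], is worthless when [f y y = 0], whence the second
    case. *)
Lemma psd_cauchy_schwarz x y : f x y ^+ 2 <= f x x * f y y.
Proof.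
have q s t : 0 <= s ^+ 2 * f x x + 2 * s * t * f x y + t ^+ 2 * f y y.
  have := f_ge0 (s *: x + t *: y).
  rewrite fD !fZ !(fC _ (_ + _)) !fD !fZ (fC y x); congr (_ <= _); ring.
have xx := f_ge0 x; have yy := f_ge0 y.
have [y0|] := eqVneq (f y y) 0; last first.
  move=> y0; have {}y0 : 0 < f y y by rewrite lt_neqAle eq_sym y0.
  have := q (f y y) (- f x y).
  have -> : f y y ^+ 2 * f x x + 2 * f y y * - f x y * f x y +
    (- f x y) ^+ 2 * f y y = f y y * (f x x * f y y - f x y ^+ 2) by ring.
  by rewrite pmulr_rge0// subr_ge0.
(* With [f y y = 0] these coefficients make the quadratic form equal to [- f x y ^+ 2]. *)
have := q (f x y) (- ((f x x + 1) / 2)); rewrite y0 !mulr0 addr0.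
set u := f x y; set v := f x x => h; rewrite -oppr_ge0.
by apply: le_trans h _; rewrite le_eqVlt; apply/orP; left; apply/eqP; field.
Qed.

End cauchy_schwarz.

Section euclidean_inequalities.
Context {R : realType} {m : nat}.
Implicit Types x y z : 'cV[R]_m.

Lemma edot_cauchy_schwarz x y : edot x y ^+ 2 <= edot x x * edot y y.
Proof.
by apply: psd_cauchy_schwarz;
  [exact: edotC|exact: edotDl|exact: edotZl|exact: edot_ge0].
Qed.

Lemma norm_edot_le x y : `|edot x y| <= enorm x * enorm y.
Proof.
rewrite -sqrtrM ?edot_ge0// -sqrtr_sqr ler_sqrt ?edot_cauchy_schwarz//.
by rewrite mulr_ge0 ?edot_ge0.
Qed.

End euclidean_inequalities.

(** * A bounded concave profile on the half-line *)

Section cap.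
Context {R : realType} (M : R).
Implicit Types z : R.

(** The parabola z - z^2 / (4M) up to its vertex z = 2M, continued by its maximum M: the slope stays
    close to 1 near 0, and the concavity is of order 1/M. *)
Definition cap z : R := M - Num.max 0 (2 * M - z) ^+ 2 / (4 * M).
Definition cap' z : R := Num.max 0 (2 * M - z) / (2 * M).

(* [cap] is C^1 with derivative [cap'], and cap'' takes the values -1/(2M)
   and 0. *)
Lemma capB_ge (M1 : 1 <= M) z0 z :
  cap z0 + cap' z0 * (z - z0) - (z - z0) ^+ 2 / (4 * M) <= cap z.
Proof.
have M0 : 0 < M by lra.
rewrite /cap /cap'; set w0 := Num.max 0 _; set w := Num.max 0 _.
have h : w ^+ 2 - w0 ^+ 2 + 2 * w0 * (z - z0) - (z - z0) ^+ 2 <= 0.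
  rewrite /w /w0.
  case: (leP 0 (2 * M - z0)) => h0; case: (leP 0 (2 * M - z)) => h1;
    have := sqr_ge0 (z - z0); nra.
rewrite -subr_le0 (_ : _ - _ =
  (w ^+ 2 - w0 ^+ 2 + 2 * w0 * (z - z0) - (z - z0) ^+ 2) / (4 * M)).
  by rewrite pmulr_lle0// invr_gt0; lra.
by field; rewrite gt_eqF.
Qed.

Lemma cap'_ge0 (M1 : 1 <= M) z : 0 <= cap' z.
Proof. by rewrite divr_ge0 ?le_max ?lexx//; lra. Qed.

Lemma cap'_le1 (M1 : 1 <= M) z : 0 <= z -> cap' z <= 1.
Proof.
by move=> z0; rewrite ler_pdivrMr ?mul1r ?ge_max; lra.
Qed.

Lemma cap'_ge (M1 : 1 <= M) z : z <= M -> 1 / 2 <= cap' z.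
Proof.
by move=> z0; rewrite ler_pdivlMr; [rewrite le_max; apply/orP; right; lra|lra].
Qed.

Lemma le_cap (M1 : 1 <= M) z z' : z <= z' -> cap z <= cap z'.
Proof.
move=> zz'; rewrite lerD2l lerN2; apply: ler_wpM2r; first by rewrite invr_ge0;
  lra.
have h (x : R) : 0 <= Num.max 0 x by rewrite le_max lexx.
rewrite lerXn2r ?nnegrE ?h// ge_max h/= le_max.
by apply/orP; right; lra.
Qed.

Lemma cap_le (M1 : 1 <= M) z : cap z <= M.
Proof. by rewrite lerBlDr lerDl divr_ge0 ?sqr_ge0//; lra. Qed.

Lemma cap0 (M1 : 1 <= M) : cap 0 = 0.
Proof.
have M0 : 0 < M by lra.
rewrite /cap subr0 max_r; last lra.
by field; rewrite gt_eqF.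
Qed.

Lemma cap_ge0 (M1 : 1 <= M) z : 0 <= z -> 0 <= cap z.
Proof. by move=> z0; rewrite -(cap0 M1) le_cap. Qed.

Lemma capE (M1 : 1 <= M) z : z <= 2 * M -> cap z = z - z ^+ 2 / (4 * M).
Proof.
have M0 : 0 < M by lra.
move=> h; rewrite /cap max_r; last lra.
by field; rewrite gt_eqF.
Qed.

Lemma capB_le (M1 : 1 <= M) z z' : 0 <= z -> z <= z' ->
  cap z' - cap z <= z' - z.
Proof.
have M0 : 0 < M by lra.
move=> z0 zz'.
case: (leP z' (2 * M)) => z'M.
  rewrite !capE; [|lra..].
  rewrite -subr_ge0.
  have -> : z' - z - (z' - z' ^+ 2 / (4 * M) - (z - z ^+ 2 / (4 * M))) =
    (z' ^+ 2 - z ^+ 2) / (4 * M) by field; rewrite gt_eqF.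
  by rewrite divr_ge0//; nra.
have := cap_le M1 z'.
case: (leP z (2 * M)) => zM; last by rewrite /cap !max_l ?expr0n/=; lra.
rewrite (capE M1 zM) => h;
  apply: le_trans (_ : M - (z - z ^+ 2 / (4 * M)) <= _).
  lra.
rewrite -subr_ge0.
have -> : z' - z - (M - (z - z ^+ 2 / (4 * M))) =
  (z' - 2 * M) + (4 * M ^+ 2 - z ^+ 2) / (4 * M) by field; rewrite gt_eqF.
by rewrite addr_ge0 ?divr_ge0//; nra.
Qed.

Lemma cap_lipschitz (M1 : 1 <= M) z z' : 0 <= z -> 0 <= z' ->
  cap z' - cap z <= `|z' - z|.
Proof.
move=> z0 z'0; case: (leP z z') => zz'.
  by rewrite ger0_norm ?subr_ge0// capB_le.
by apply: le_trans (normr_ge0 _); rewrite subr_le0 le_cap// ltW.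
Qed.

End cap.

(** * The radial potential and its second-order lower bounds *)

Section potential.
Context {R : realType} {m : nat} (M : R).
Implicit Types x y v : 'cV[R]_m.

(** The length of the vector (1, y): a smooth substitute for |y| which is 1-Lipschitz and, unlike
    |y|, strictly convex also in the radial direction. *)
Definition jnorm y : R := Num.sqrt (1 + edot y y).

Definition pot y : R := cap M (jnorm y - 1).

(** The gradient of [pot]. No derivative is ever taken; it enters as the linear term of the lower
    bounds [potD_ge] and [potD_gain]. *)
Definition dpot y : 'cV[R]_m := (cap' M (jnorm y - 1) / jnorm y) *: y.

Lemma sqr_jnorm y : jnorm y ^+ 2 = 1 + edot y y.
Proof. by rewrite sqr_sqrtr// addr_ge0// edot_ge0. Qed.

Lemma jnorm_ge1 y : 1 <= jnorm y.
Proof.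
by rewrite /jnorm -[leLHS]sqrtr1 ler_sqrt ?lerDl ?edot_ge0 ?addr_ge0 ?edot_ge0.
Qed.

(* Cauchy-Schwarz for the vectors (1, x) and (1, y). *)
Lemma jnormM_ge x y : 1 + edot x y <= jnorm x * jnorm y.
Proof.
have x1 := jnorm_ge1 x; have y1 := jnorm_ge1 y.
have := edot_cauchy_schwarz x y.
have := edot_ge0 (x - y).
rewrite edotDl !edotDr -[- y]scaleN1r !edotZl !edotZr (edotC y x).
move: (sqr_jnorm x) (sqr_jnorm y) => jx jy.
move=> h1 h2; have h3 : (1 + edot x y) ^+ 2 <= (jnorm x * jnorm y) ^+ 2.
  rewrite exprMn jx jy; nra.
apply: le_trans (ler_norm _) _.
rewrite -(ler_pXn2r (n := 2)) ?nnegrE// ?real_normK ?num_real//.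
by rewrite mulr_ge0//; lra.
Qed.

(** Law of cosines for (1, y) and (1, y + v): |v|^2 exceeds the squared increment of the length by
    twice the Cauchy-Schwarz defect. This defect is what measures the convexity of [jnorm]. *)
Lemma sqr_jnormB y v : (jnorm (y + v) - jnorm y) ^+ 2 =
  edot v v - 2 * (jnorm y * jnorm (y + v) - 1 - edot y (y + v)).
Proof.
have := sqr_jnorm y; have := sqr_jnorm (y + v).
rewrite edotDl !edotDr (edotC v y) sqrrB => -> ->; ring.
Qed.

Lemma jnormB_le y v : (jnorm (y + v) - jnorm y) ^+ 2 <= edot v v.
Proof. by rewrite sqr_jnormB; have := jnormM_ge y (y + v); lra. Qed.

(** With p and q the two lengths, q - p = (q^2 - p^2 - (q - p)^2) / (2p). This exact identity takes
    the place of a Taylor expansion, and its remainder is nonnegative by [jnormB_le]. *)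
Lemma jnormB y v : jnorm (y + v) - jnorm y =
  edot y v / jnorm y
  + (edot v v - (jnorm (y + v) - jnorm y) ^+ 2) / (2 * jnorm y).
Proof.
have p1 := jnorm_ge1 y; have p0 : jnorm y != 0 by rewrite gt_eqF//; lra.
have h1 := sqr_jnorm y; have h2 := sqr_jnorm (y + v).
rewrite edotDl !edotDr (edotC v y) in h2.
apply/eqP; rewrite -subr_eq0; apply/eqP.
set u := edot y v; set w := edot v v; set p := jnorm y; set p' := jnorm (y + v).
have -> : p' - p - (u / p + (w - (p' - p) ^+ 2) / (2 * p)) =
  (p' ^+ 2 - p ^+ 2 - 2 * u - w) / (2 * p) by field.
by rewrite h1 h2 (_ : _ - w = 0) ?mul0r// /u /w; ring.
Qed.

Lemma pot_ge0 (M1 : 1 <= M) y : 0 <= pot y.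
Proof. by apply: cap_ge0 => //; rewrite subr_ge0 jnorm_ge1. Qed.

Lemma pot_le (M1 : 1 <= M) y : pot y <= M.
Proof. exact: cap_le. Qed.

Lemma le_pot (M1 : 1 <= M) x y : enorm x <= enorm y -> pot x <= pot y.
Proof.
move=> xy; apply: le_cap => //; rewrite lerD2r ler_sqrt ?lerD2l -?le_enorm//.
by rewrite addr_ge0 ?edot_ge0.
Qed.

Lemma pot_lipschitz (M1 : 1 <= M) x y : pot (x + y) - pot x <= enorm y.
Proof.
apply: le_trans (cap_lipschitz M1 _ _) _; rewrite ?subr_ge0 ?jnorm_ge1//.
rewrite opprB addrA subrK -sqrtr_sqr ler_sqrt ?edot_ge0//; exact: jnormB_le.
Qed.

Lemma pot_le_enorm (M1 : 1 <= M) x : pot x <= enorm x.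
Proof.
have := pot_lipschitz M1 0 x; rewrite add0r.
have -> : pot (0 : 'cV_m) = 0; last by rewrite subr0.
rewrite /pot /jnorm (_ : edot 0 0 = 0) ?addr0 ?sqrtr1 ?subrr ?cap0//.
by rewrite /edot big1// => i _; rewrite mxE mul0r.
Qed.

Lemma pot_ge (M1 : 1 <= M) x : 1 <= enorm x -> 1 / 5 <= pot x.
Proof.
(* The true bound sqrt 2 is weakened to 5/4, and cap(1/4) = 1/4 - 1/(64 M) is still at least 1/5. *)
move=> x1; have : 5 / 4 - 1 <= jnorm x - 1.
  rewrite lerD2r -[leLHS]ger0_norm -?sqrtr_sqr ?ler_sqrt; first last.
  - lra.
  - by rewrite addr_ge0 ?edot_ge0.
  - rewrite -sqr_enorm; nra.
move=> /(le_cap M1); apply: le_trans; rewrite capE//; last lra.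
rewrite lerBrDr -lerBrDl ler_pdivrMr; nra.
Qed.

Lemma enorm_dpot (M1 : 1 <= M) y : enorm (dpot y) <= 1.
Proof.
have p1 := jnorm_ge1 y; have p0 : 0 < jnorm y by lra.
have c0 := cap'_ge0 M1 (jnorm y - 1).
have c1 : cap' M (jnorm y - 1) <= 1 by apply: cap'_le1 => //; lra.
rewrite enormZ ger0_norm; last by apply: divr_ge0 c0 (ltW p0).
have : enorm y <= jnorm y.
  by rewrite ler_sqrt ?lerDr// addr_ge0 ?edot_ge0.
rewrite mulrAC ler_pdivrMr// => h; have := enorm_ge0 y; nra.
Qed.

(** The exact expansion of [jnorm] is inserted into [capB_ge]: the loss |v|^2 / (4M) is the
    concavity of [cap], the last term on the left is the convexity of [jnorm]. *)
Lemma potD_aux (M1 : 1 <= M) y v :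
  pot y + edot (dpot y) v - edot v v / (4 * M)
    + cap' M (jnorm y - 1)
        * ((edot v v - (jnorm (y + v) - jnorm y) ^+ 2) / (2 * jnorm y))
  <= pot (y + v).
Proof.
have := capB_ge M1 (jnorm y - 1) (jnorm (y + v) - 1).
rewrite -/(pot y) -/(pot (y + v)) opprB addrA subrK.
apply: le_trans; rewrite {2}jnormB /dpot edotZl mulrDr.
set c := cap' _ _; set p := jnorm y; set q := jnorm (y + v); set e := edot v v.
have -> : c / p * edot y v = c * (edot y v / p) by ring.
have : (q - p) ^+ 2 / (4 * M) <= e / (4 * M).
  by apply: ler_wpM2r; [rewrite invr_ge0; lra|exact: jnormB_le].
lra.
Qed.

Lemma potD_ge (M1 : 1 <= M) y v :
  pot y + edot (dpot y) v - edot v v / (4 * M) <= pot (y + v).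
Proof.
apply: le_trans (potD_aux M1 y v); rewrite lerDl mulr_ge0 ?cap'_ge0//.
rewrite divr_ge0 ?subr_ge0 ?jnormB_le//.
by have := jnorm_ge1 y; lra.
Qed.

(** Let p and q be the [jnorm] of y and y + v. The slope of [cap] is at least 1/2 and the convexity
    term is at least |v|^2 / (pq), so the gain is at least |v|^2 / (4 p^2 q); the constant comes
    from p^2 <= 2 and q <= 2 + K. *)
Lemma potD_gain (M1 : 1 <= M) K y v : enorm y <= 1 -> enorm v <= K ->
  pot y + edot (dpot y) v - edot v v / (4 * M) + edot v v / (8 * (2 + K))
    <= pot (y + v).
Proof.
move=> y1 vK; apply: le_trans (potD_aux M1 y v); rewrite lerD2l.
have p1 := jnorm_ge1 y; have q1 := jnorm_ge1 (y + v).
have p2 : jnorm y ^+ 2 <= 2.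
  by rewrite sqr_jnorm -sqr_enorm; have := enorm_ge0 y; nra.
have pq := jnormB_le y v.
have K0 := le_trans (enorm_ge0 v) vK.
have qK : jnorm (y + v) <= 2 + K.
  suff : jnorm (y + v) - jnorm y <= K by nra.
  apply: le_trans vK; apply: le_trans (ler_norm _) _.
  by rewrite -sqrtr_sqr ler_sqrt ?edot_ge0.
have c2 : 1 / 2 <= cap' M (jnorm y - 1) by apply: cap'_ge => //; nra.
(* Write a for the product of y and y + v. Then (pq - 1 - a)(pq + 1 + a) equals |v|^2 plus the
   Cauchy-Schwarz defect of y and y + v, and the second factor is at most 2pq. Hence the bound holds
   in every direction of v. *)
have gain : edot v v <= (edot v v - (jnorm (y + v) - jnorm y) ^+ 2)
    * (jnorm y * jnorm (y + v)).
  have e1 := edot_cauchy_schwarz y (y + v).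
  have e2 := jnormM_ge y (y + v).
  have e3 := sqr_jnorm y; have e4 := sqr_jnorm (y + v).
  rewrite sqr_jnormB; set g := jnorm y * _ - 1 - edot y (y + v).
  have e5 : edot v v = edot y y - 2 * edot y (y + v) + edot (y + v) (y + v).
    by rewrite edotDl !edotDr (edotC v y); ring.
  have e6 : edot v v <= g * (jnorm y * jnorm (y + v) + 1 + edot y (y + v)).
    rewrite /g; set a := edot y (y + v) in e1 e2 e5 *.
    have -> : (jnorm y * jnorm (y + v) - 1 - a) * (jnorm y * jnorm (y + v) + 1
      + a)
      = jnorm y ^+ 2 * jnorm (y + v) ^+ 2 - (1 + a) ^+ 2 by ring.
    by rewrite e3 e4 e5; nra.
  have g0 : 0 <= g by rewrite /g; lra.
  by nra.
set g := _ - _ in gain *; set c := cap' _ _ in c2 *.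
have w0 := edot_ge0 v.
have g0 : 0 <= g by rewrite /g; lra.
rewrite ler_pdivrMr; last lra.
have -> : c * (g / (2 * jnorm y)) * (8 * (2 + K)) =
  (4 * c * g * (2 + K)) / jnorm y by field; rewrite gt_eqF//; lra.
rewrite ler_pdivlMr; last lra.
have gK : 0 <= g * (2 + K) by rewrite mulr_ge0//; lra.
have cg : g * (2 + K) <= 2 * c * g * (2 + K).
  have -> : 2 * c * g * (2 + K) = 2 * c * (g * (2 + K)) by ring.
  by nra.
have : edot v v * jnorm y <= 2 * (g * (2 + K)); last lra.
have p0 : 0 < jnorm y by lra.
have : edot v v * jnorm y <= g * jnorm (y + v) * jnorm y ^+ 2.
  have -> : g * jnorm (y + v) * jnorm y ^+ 2 =
    (g * (jnorm y * jnorm (y + v))) * jnorm y by ring.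
  by rewrite ler_wpM2r// ltW.
move=> h; apply: le_trans h _.
rewrite mulrC ler_pM ?sqr_ge0 ?mulr_ge0//; first lra.
by rewrite ler_wpM2l.
Qed.

End potential.

(** * Integration against measurable weights *)

Section vector_measurability.
Context {R : realType} {m : nat} d (T : measurableType d).
Implicit Types y z : T -> 'cV[R]_m.

Definition vmeasurable (p : nat) (y : T -> 'cV[R]_p) :=
  forall i, measurable_fun [set: T] (fun w => y w i 0).

Lemma measurable_edot y z : vmeasurable y -> vmeasurable z ->
  measurable_fun [set: T] (fun w => edot (y w) (z w)).
Proof.
by move=> my mz; apply: measurable_sum => i; exact: measurable_funM.
Qed.

Lemma measurable_sqrt (f : T -> R) : measurable_fun [set: T] f ->
  measurable_fun [set: T] (fun w => Num.sqrt (f w)).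
Proof.
by move=> mf; apply: measurableT_comp mf => //;
  apply: continuous_measurable_fun; exact: sqrt_continuous.
Qed.

Lemma measurable_enorm y : vmeasurable y ->
  measurable_fun [set: T] (fun w => enorm (y w)).
Proof. by move=> my; apply/measurable_sqrt/measurable_edot. Qed.

Lemma measurable_jnorm y : vmeasurable y ->
  measurable_fun [set: T] (fun w => jnorm (y w)).
Proof.
by move=> my; apply/measurable_sqrt/measurable_funD => //;
  exact: measurable_edot.
Qed.

Lemma measurable_max0 M (f : T -> R) : measurable_fun [set: T] f ->
  measurable_fun [set: T] (fun w => Num.max 0 (M - f w)).
Proof.
by move=> mf; apply: measurable_maxr => //; exact: measurable_funB.
Qed.

Lemma measurable_pot M y : vmeasurable y ->
  measurable_fun [set: T] (fun w => pot M (y w)).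
Proof.
move=> my; apply: measurable_funB => //; apply: measurable_funM => //.
apply: measurable_funX; apply: measurable_max0; apply: measurable_funB => //.
exact: measurable_jnorm.
Qed.

Lemma vmeasurableZ (f : T -> R) y : measurable_fun [set: T] f ->
  vmeasurable y -> vmeasurable (fun w => f w *: y w).
Proof.
move=> mf my i; under eq_fun do rewrite mxE.
exact: measurable_funM.
Qed.

Lemma vmeasurableD y z : vmeasurable y -> vmeasurable z ->
  vmeasurable (fun w => y w + z w).
Proof.
move=> my mz i; under eq_fun do rewrite mxE.
exact: measurable_funD.
Qed.

Lemma vmeasurable_mulmx p (B : 'M[R]_(p, m)) y : vmeasurable y ->
  vmeasurable (fun w => B *m y w).
Proof.
move=> my i; under eq_fun do rewrite mxE.
by apply: measurable_sum => j; exact: measurable_funM.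
Qed.

Lemma vmeasurable_dpot M y : vmeasurable y ->
  vmeasurable (fun w => dpot M (y w)).
Proof.
move=> my; apply: vmeasurableZ => //; apply: measurable_funM.
  apply: measurable_funM => //; apply: measurable_max0;
    apply: measurable_funB => //.
  exact: measurable_jnorm.
(* The inverse is treated as the power -1, which agrees with it because [jnorm] is positive. *)
under eq_fun => w do rewrite -(powR_inv1 (le_trans ler01 (jnorm_ge1 (y w)))).
apply: measurableT_comp (measurable_powR (-1)) _.
exact: measurable_jnorm.
Qed.

End vector_measurability.

Section sub_sigma_algebra.
Context d (T : measurableType d) (G : set (set T)).
Hypothesis sG : sigma_algebra setT G.

Lemma measurable_wrtE : (measurable : set (set (g_sigma_algebraType G))) = G.
Proof. exact: measurable_g_measurableTypeE. Qed.

Lemma sub_setT : G setT.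
Proof. by rewrite -measurable_wrtE; exact: measurableT. Qed.

Lemma sub_setC A : G A -> G (~` A).
Proof. by rewrite -measurable_wrtE; exact: measurableC. Qed.

Lemma sub_setI A B : G A -> G B -> G (A `&` B).
Proof. by rewrite -measurable_wrtE; exact: measurableI. Qed.

Lemma sub_setU A B : G A -> G B -> G (A `|` B).
Proof. by rewrite -measurable_wrtE; exact: measurableU. Qed.

Lemma sub_setD A B : G A -> G B -> G (A `\` B).
Proof. by rewrite -measurable_wrtE; exact: measurableD. Qed.

Lemma sub_preimage d' (U : measurableType d') (f : T -> U) (Y : set U) :
  measurable_wrt G f -> measurable Y -> G (f @^-1` Y).
Proof.
by move=> mf mY; rewrite -measurable_wrtE -[X in measurable X]setTI; exact: mf.
Qed.

Lemma measurable_wrt_sub d' (U : measurableType d') (f : T -> U) :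
  G `<=` measurable -> measurable_wrt G f -> measurable_fun [set: T] f.
Proof.
by move=> GT mf _ Y mY; rewrite setTI; apply: GT; exact: sub_preimage.
Qed.

End sub_sigma_algebra.

Section integral_tools.
Context d (T : measurableType d) (R : realType) (P : probability T R).
Implicit Types (A B : set T) (f g : T -> R).

Lemma integrable_le A f g : measurable A -> measurable_fun [set: T] f ->
  (forall w, A w -> `|f w| <= g w) -> P.-integrable A (EFin \o g) ->
  P.-integrable A (EFin \o f).
Proof.
move=> mA mf fg; apply: le_integrable => //.
  by apply/measurable_EFinP; apply: measurable_funS mf.
by move=> w Aw; rewrite lee_fin (le_trans (fg _ Aw))// ler_norm.
Qed.

Lemma integrable_bounded A f k : measurable A -> measurable_fun [set: T] f ->
  (forall w, A w -> `|f w| <= k) -> P.-integrable A (EFin \o f).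
Proof.
move=> mA mf fk; apply: integrable_le mf _ _ => //; first exact: fk.
exact: finite_measure_integrable_cst.
Qed.

Lemma Rintegral_setID A B f : measurable A -> measurable B ->
  P.-integrable A (EFin \o f) ->
  \int[P]_(x in A) f x
    = \int[P]_(x in A `&` B) f x + \int[P]_(x in A `\` B) f x.
Proof.
move=> mA mB If; rewrite -{1}(setUIDK A B) Rintegral_setU//.
- exact: measurableI.
- exact: measurableD.
- by rewrite setUIDK.
- by apply/disj_setPS => x [[_ Bx] [_]].
Qed.

(* If [g] stays within [0, e] of [t] on [A] then [f] integrates on [A] against
   [g] as against [g - t]; larger ranges are halved until this applies. *)
Lemma norm_Rintegral_mul_le (G : set (set T)) B f g (e : R) n :
  sigma_algebra setT G -> G `<=` measurable -> G B ->
  P.-integrable B (EFin \o f) -> measurable_fun [set: T] f ->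
  (forall A, G A -> A `<=` B -> \int[P]_(x in A) f x = 0) ->
  measurable_wrt G g -> 0 <= e ->
  forall A t, G A -> A `<=` B ->
  (forall w, A w -> t <= g w <= t + 2 ^+ n * e) ->
  `| \int[P]_(x in A) (g x * f x) | <= e * \int[P]_(x in A) `|f x|.
Proof.
move=> sG GT GB If mf f0 mg e0.
have mgT := measurable_wrt_sub sG GT mg.
have Igf A t s : G A -> A `<=` B -> (forall w, A w -> t <= g w <= s) ->
    P.-integrable A (EFin \o (fun w => g w * f w)).
  move=> GA AB tg; apply: integrable_le (GT _ GA) _ _ _.
  - exact: measurable_funM.
  - move=> w Aw; rewrite normrM.
    have : `|g w| <= `|t| + `|s|.
      have /andP[h1 h2] := tg w Aw.
      have := ler_norm s; have := ler_norm (- t); rewrite normrN.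
      have := normr_ge0 s; have := normr_ge0 t.
      by rewrite ler_norml; move=> *; apply/andP; split; lra.
    by move=> h; apply: ler_wpM2r h.
  - have IfA : P.-integrable A (EFin \o f).
      by apply: integrableS AB If; exact: GT.
    exact: (integrableZl (GT _ GA) (`|t| + `|s|) (integrable_norm IfA)).
elim: n => [|n IH] A t GA AB tg.
  rewrite expr0 mul1r in tg.
  have IfA : P.-integrable A (EFin \o f) by apply: integrableS AB If; exact: GT.
  have -> : \int[P]_(x in A) (g x * f x) = \int[P]_(x in A) ((g x - t) * f x).
    under [RHS]eq_Rintegral do rewrite mulrBl.
    rewrite RintegralB ?RintegralZl ?f0 ?mulr0 ?subr0//; try exact: GT.
    - exact: Igf tg.
    - exact: (integrableZl (GT _ GA) t IfA).
  have Igt : P.-integrable A (EFin \o (fun w => (g w - t) * f w)).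
    rewrite (_ : EFin \o _ = ((EFin \o (fun w => (g w * f w)%R)) \-
      (EFin \o (fun w => (t * f w)%R)))%E).
      apply: integrableB; [exact: GT|exact: Igf tg|].
      exact: (integrableZl (GT _ GA) t IfA).
    by apply/funext => w /=; rewrite mulrBl EFinB.
  apply: le_trans (le_normr_Rintegral (GT _ GA) Igt) _.
  rewrite -RintegralZl; [|exact: GT|exact: integrable_norm].
  apply: le_Rintegral; [exact: GT|exact: integrable_norm| |].
    exact: (integrableZl (GT _ GA) e (integrable_norm IfA)).
  move=> w Aw; rewrite normrM ler_wpM2r//.
  by have /andP[h1 h2] := tg w Aw; rewrite ger0_norm; lra.
pose D := [set w | g w <= t + 2 ^+ n * e].
have GD : G D.
  rewrite (_ : D = g @^-1` [set` `]-oo, t + 2 ^+ n * e]]).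
    exact: (sub_preimage sG mg).
  by apply/seteqP; split => w /=; rewrite in_itv.
have IfA : P.-integrable A (EFin \o (fun w => `|f w|)).
  by apply: integrable_norm; apply: integrableS AB If; exact: GT.
rewrite (Rintegral_setID (GT _ GA) (GT _ GD) (Igf _ _ _ GA AB tg)).
rewrite (Rintegral_setID (GT _ GA) (GT _ GD) IfA) mulrDr.
apply: le_trans (ler_normD _ _) _; rewrite lerD//.
- apply: (IH _ t); [exact: sub_setI|by move=> w [/AB]|].
  by move=> w [Aw Dw]; have /andP[-> _] := tg w Aw.
- apply: (IH _ (t + 2 ^+ n * e)); [exact: sub_setD|by move=> w [/AB]|].
  move=> w [Aw /negP Dw]; have /andP[_ gt] := tg w Aw.
  apply/andP; split; first by rewrite ltW// ltNge.
  by apply: le_trans gt _; rewrite exprS; lra.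
Qed.

(** Passes from vanishing integrals over events of [G] to vanishing integrals against bounded
    [G]-measurable weights: the bound of [norm_Rintegral_mul_le] holds for the range [-1, 1] cut
    into 2^n pieces of length 2 / 2^n, and n is arbitrary. *)
Lemma Rintegral_mul_eq0 (G : set (set T)) B f g :
  sigma_algebra setT G -> G `<=` measurable -> G B ->
  P.-integrable B (EFin \o f) -> measurable_fun [set: T] f ->
  (forall A, G A -> A `<=` B -> \int[P]_(x in A) f x = 0) ->
  measurable_wrt G g -> (forall w, `|g w| <= 1) ->
  \int[P]_(x in B) (g x * f x) = 0.
Proof.
move=> sG GT GB If mf f0 mg g1.
set I := \int[P]_(x in B) `|f x|.
have I0 : 0 <= I by apply: Rintegral_ge0.
apply/normr0_eq0/le_anti; rewrite normr_ge0 andbT.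
have h n : `| \int[P]_(x in B) (g x * f x) | <= (2 / 2 ^+ n) * I.
  have n0 : 0 <= 2 / 2 ^+ n :> R by rewrite divr_ge0// exprn_ge0.
  apply: (norm_Rintegral_mul_le (n := n) sG GT GB If mf f0 mg n0 (t :=
    -1) GB) => //.
  move=> w _; rewrite mulrC divfK; last by rewrite expf_neq0.
  by have := g1 w; rewrite ler_norml => /andP[h1 h2]; apply/andP; split; lra.
apply/ler_addgt0Pl => e e0; rewrite addr0.
have [n hn] : exists n : nat, 2 * I / e < 2 ^+ n.
  exists (Num.truncn (2 * I / e)).+1.
  apply: lt_le_trans (truncnS_gt _) _; by rewrite -natrX ler_nat;
    exact/ltnW/ltn_expl.
apply: le_trans (h n) _; rewrite mulrAC ler_pdivrMr ?exprn_gt0//.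
by rewrite [leRHS]mulrC; apply: ltW; rewrite -ltr_pdivrMr.
Qed.

End integral_tools.

(** * Approximation by events of the filtration *)

Section real_probability.
Context d (T : measurableType d) (R : realType) (P : probability T R).
Implicit Types A B : set T.

Definition pr A : R := fine (P A).

Lemma prE A : measurable A -> P A = (pr A)%:E.
Proof. by move=> mA; rewrite fineK// fin_num_measure. Qed.

Lemma pr_ge0 A : 0 <= pr A.
Proof. exact: fine_ge0. Qed.

Lemma le_pr A B : measurable A -> measurable B -> A `<=` B -> pr A <= pr B.
Proof.
by move=> mA mB AB; rewrite -lee_fin -!prE//; apply: le_measure; rewrite ?inE.
Qed.

Lemma pr_setID A B : measurable A -> measurable B ->
  pr A = pr (A `&` B) + pr (A `\` B).
Proof.
move=> mA mB; apply: EFin_inj; rewrite EFinD -!prE//.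
- by rewrite addeC; exact: measureDI.
- exact: measurableD.
- exact: measurableI.
Qed.

Lemma pr_setU_le A B : measurable A -> measurable B ->
  pr (A `|` B) <= pr A + pr B.
Proof.
move=> mA mB; rewrite -lee_fin EFinD -!prE//; last exact: measurableU.
exact: measureU2.
Qed.

Lemma Rintegral_pr A (k : R) : measurable A -> \int[P]_(x in A) k = k * pr A.
Proof. by move=> mA; rewrite Rintegral_cst. Qed.

Lemma pr_nonincreasing_lt (D : nat -> set T) (e : R) :
  (forall n, measurable (D n)) -> (forall n, D n.+1 `<=` D n) ->
  \bigcap_n D n = set0 -> 0 < e ->
  exists N, forall n, (N <= n)%N -> pr (D n) < e.
Proof.
move=> mD dD D0 e0.
have ni : nonincreasing_seq D.
  by apply/nonincreasing_seqP => n; apply/subsetPset; exact: dD.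
have : (fun n => pr (D n)) @ \oo --> (0 : R).
  apply: (@fine_cvg _ _ _ _ (P \o D) 0).
  have := @nonincreasing_cvg_mu _ _ _ P D.
  rewrite D0 measure0; apply => //.
  by rewrite -ge0_fin_numE// fin_num_measure.
move=> /cvgrPdist_lt /(_ _ e0)[N _ h]; exists N => n Nn.
by have := h n Nn; rewrite sub0r normrN ger0_norm ?pr_ge0.
Qed.

End real_probability.

Section approximation.
Context d (T : measurableType d) (R : realType) (P : probability T R).
Variable F : nat -> set (set T).
Implicit Types A B E : set T.

(** Closure of the union of the [F n] for the pseudometric P(A symmetric difference E). It is a
    sigma-algebra, and working in it replaces an appeal to Levy's zero-one law. *)
Definition approximable E := measurable E /\ forall e : R, 0 < e ->
  exists n A, F n A /\ pr P ((A `\` E) `|` (E `\` A)) < e.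

Hypothesis FF : filtration F.

Let sF n : sigma_algebra setT (F n). Proof. by case: FF. Qed.
Let mF n A : F n A -> measurable A. Proof. by case: FF => _ + _; exact. Qed.
Let leF m n A : (m <= n)%N -> F m A -> F n A.
Proof. by case: FF => _ _ h /h; exact. Qed.

Lemma approximable_sub n A : F n A -> approximable A.
Proof.
move=> FA; split; first exact: mF FA.
by move=> e e0; exists n, A; rewrite setDv setU0 /pr measure0.
Qed.

Lemma approximableC E : approximable E -> approximable (~` E).
Proof.
move=> [mE aE]; split; first exact: measurableC.
move=> e /aE[n [A [FA Ae]]]; exists n, (~` A); split; first exact: sub_setC.
rewrite (_ : _ `|` _ = (A `\` E) `|` (E `\` A))//.
by rewrite setUC; congr setU; rewrite !setDE setCK setIC.
Qed.

Lemma approximableU E1 E2 :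
  approximable E1 -> approximable E2 -> approximable (E1 `|` E2).
Proof.
move=> [mE1 a1] [mE2 a2]; split; first exact: measurableU.
move=> e e0; have e20 : 0 < e / 2 by rewrite divr_gt0.
have [n1 [A1 [FA1 p1]]] := a1 _ e20; have [n2 [A2 [FA2 p2]]] := a2 _ e20.
exists (maxn n1 n2), (A1 `|` A2); split.
  by apply: sub_setU => //; [apply: leF FA1|apply: leF FA2];
    rewrite ?leq_maxl ?leq_maxr.
have mA1 := mF FA1; have mA2 := mF FA2.
rewrite [ltRHS]splitr; apply: le_lt_trans (ltrD p1 p2).
have mS (A E : set T) : measurable A -> measurable E ->
    measurable ((A `\` E) `|` (E `\` A)).
  by move=> mA mE; apply: measurableU; exact: measurableD.
apply: le_trans (pr_setU_le _ (mS _ _ mA1 mE1) (mS _ _ mA2 mE2)).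
apply: le_pr; try by apply: measurableU; apply: mS.
  by apply: mS; exact: measurableU.
by move=> w; rewrite /setU /setD /=; tauto.
Qed.

(** Half of the error is spent on replacing the union by a finite one, by continuity of [P] from
    above, and half on approximating the finite union. *)
Lemma approximable_bigcup (E : nat -> set T) :
  (forall i, approximable (E i)) -> approximable (\bigcup_i E i).
Proof.
move=> aE; have mE i : measurable (E i) by case: (aE i).
have mU : measurable (\bigcup_i E i) by exact: bigcupT_measurable.
split => // e e0; have e20 : 0 < e / 2 by rewrite divr_gt0.
pose U n := \big[setU/set0]_(i < n) E i.
have aU n : approximable (U n).
  elim: n => [|n IH]; rewrite /U ?big_ord0 ?big_ord_recr/=.
    by apply: (@approximable_sub 0); case: (sF 0).
  exact: approximableU.
pose D n := (\bigcup_i E i) `\` U n.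
have mD n : measurable (D n) by apply: measurableD => //; case: (aU n).
have [||N /(_ N (leqnn N)) DN] := pr_nonincreasing_lt P mD _ _ e20.
- by move=> n; apply: setDS; rewrite /U big_ord_recr/=; exact: subsetUl.
- rewrite -subset0 => w Dw; have [[i _ Ei] _] := Dw 0%N I.
  have [_] := Dw i.+1 I; apply; rewrite /U big_ord_recr/=; by right.
have [mN /(_ _ e20)[n [A [FA An]]]] := aU N.
exists n, A; split => //; rewrite [ltRHS]splitr;
  apply: le_lt_trans (ltrD An DN).
have mA := mF FA.
have mS : measurable ((A `\` U N) `|` (U N `\` A)).
  by apply: measurableU; exact: measurableD.
apply: le_trans (pr_setU_le _ mS (mD N)); apply: le_pr.
- by apply: measurableU; exact: measurableD.
- exact: measurableU.
- move=> w [[Aw Ew]|[Ew Aw]].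
    left; left; split => // Uw; apply: Ew; move: Uw.
    by rewrite /U -bigcup_mkord => -[i _ Ei]; exists i.
  have [Uw|Uw] := pselect (U N w); first by left; right.
  by right.
Qed.

Lemma approximable_bigcap (E : nat -> set T) :
  (forall i, approximable (E i)) -> approximable (\bigcap_i E i).
Proof.
move=> aE; rewrite -[X in approximable X]setCK setC_bigcap.
by apply: approximableC; apply: approximable_bigcup => i; exact: approximableC.
Qed.

Lemma approximableI E1 E2 :
  approximable E1 -> approximable E2 -> approximable (E1 `&` E2).
Proof.
move=> a1 a2; rewrite -[X in approximable X]setCK setCI.
by apply/approximableC/approximableU; exact: approximableC.
Qed.

Lemma approximable_density E N (e : R) : approximable E -> 0 < pr P E ->
  0 < e ->
  exists n A, [/\ (N <= n)%N, F n A, 0 < pr P A & pr P (A `\` E) <= e * pr P A].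
Proof.
move=> [mE aE] E0 e0; set p := pr P E in E0 *.
(* The solution of t = e (p - t): then P(A \ E) < t = e (p - t) <= e P(A), because P(A) >= p - t. *)
pose t := e * p / (1 + e).
have e10 : 0 < 1 + e by lra.
have t0 : 0 < t by rewrite divr_gt0// mulr_gt0.
have [n [A [FA At]]] := aE _ t0.
have mA := mF FA.
have mAE := measurableD mA mE; have mEA := measurableD mE mA.
have mS := measurableU _ _ mAE mEA.
have h1 : pr P (A `\` E) < t.
  by apply: le_lt_trans At; apply: le_pr mAE mS _; exact: subsetUl.
have h2 : pr P (E `\` A) < t.
  by apply: le_lt_trans At; apply: le_pr mEA mS _; exact: subsetUr.
have h3 : p <= pr P A + t.
  rewrite /p (pr_setID _ mE mA); apply: lerD (ltW h2).
  by apply: le_pr => //; exact: measurableI.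
have te : t * (1 + e) = e * p by rewrite divfK// gt_eqF.
exists (maxn N n), A; rewrite leq_maxl; split => //; last 2 first.
- by nra.
- by apply: ltW; apply: lt_le_trans h1 _; nra.
- by apply: leF FA; rewrite leq_maxr.
Qed.

End approximation.

(** * One step of the recursion *)

Section one_step.
Context d (T : measurableType d) (R : realType) (P : probability T R) (m : nat).

Definition trunc_sqr (K : R) (v : 'cV[R]_m) : R :=
  if enorm v <= K then edot v v else 0.

(** Conditional bounds on the noise written as integrals over the subevents of [B] in [G], so that
    they can hold on [B] alone. The lower bound concerns the truncated square because [potD_gain]
    rewards only increments of bounded length. *)
Record noise_on (G : set (set T)) (B : set T) (e : T -> 'cV[R]_m) (b C K : R) :
    Prop := NoiseOn {
  noise_measurable : vmeasurable e;
  noise_integrable : P.-integrable B (EFin \o (fun w => edot (e w) (e w)));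
  noise_mean : forall i A, G A -> A `<=` B -> \int[P]_(x in A) e x i 0 = 0;
  noise_upper : forall A, G A -> A `<=` B ->
    \int[P]_(x in A) edot (e x) (e x) <= C * pr P A;
  noise_lower : forall A, G A -> A `<=` B ->
    b * pr P A <= \int[P]_(x in A) trunc_sqr K (e x) }.

Lemma Rintegral_sum A I (s : seq I) (f : I -> T -> R) : measurable A ->
  (forall i, P.-integrable A (EFin \o f i)) ->
  P.-integrable A (EFin \o (fun w => \sum_(i <- s) f i w)) /\
  \int[P]_(x in A) \sum_(i <- s) f i x = \sum_(i <- s) \int[P]_(x in A) f i x.
Proof.
move=> mA If; elim: s => [|i s [IH1 IH2]].
  split.
    rewrite (_ : EFin \o _ = cst 0%E); first exact: integrable0.
    by apply/funext => w /=; rewrite big_nil.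
  under eq_Rintegral do rewrite big_nil.
  by rewrite big_nil Rintegral_cst// mul0r.
have E : (fun w => \sum_(j <- i :: s) f j w) =
    (fun w => f i w + \sum_(j <- s) f j w).
  by apply/funext => w; rewrite big_cons.
split; first by rewrite E; exact: (integrableD mA (If i) IH1).
by rewrite E RintegralD// IH2 big_cons.
Qed.

Lemma integrable_edot G B e b C K A (u : T -> 'cV[R]_m) :
  noise_on G B e b C K -> measurable A -> measurable B -> A `<=` B ->
  vmeasurable u -> (forall w, enorm (u w) <= 1) ->
  P.-integrable A (EFin \o (fun w => edot (u w) (e w))).
Proof.
move=> [me Ie _ _ _] mA mB AB mu u1.
have IA : P.-integrable A (EFin \o (fun w => 1 + edot (e w) (e w))).
  exact: (integrableD mA (finite_measure_integrable_cst P 1 mA)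
    (integrableS mB mA AB Ie)).
apply: integrable_le IA => //; first exact: measurable_edot.
move=> w _; apply: le_trans (norm_edot_le _ _) _; rewrite -sqr_enorm.
by have := enorm_ge0 (e w); have := enorm_ge0 (u w); have := u1 w; nra.
Qed.

Lemma integrable_coord G B e b C K A i :
  noise_on G B e b C K -> measurable A -> measurable B -> A `<=` B ->
  P.-integrable A (EFin \o (fun w => e w i 0)).
Proof.
move=> [me Ie _ _ _] mA mB AB.
have IA : P.-integrable A (EFin \o (fun w => 1 + edot (e w) (e w))).
  exact: (integrableD mA (finite_measure_integrable_cst P 1 mA)
    (integrableS mB mA AB Ie)).
apply: integrable_le IA => // w _.
apply: le_trans (coord_le_enorm _ _) _; rewrite -sqr_enorm.
by have := enorm_ge0 (e w); nra.
Qed.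

(** Makes the first-order term of the expansion disappear: each coordinate of [u] is a weight
    bounded by 1, to which [Rintegral_mul_eq0] applies. *)
Lemma Rintegral_edot_eq0 G B e b C K A (u : T -> 'cV[R]_m) :
  sigma_algebra setT G -> G `<=` measurable -> G B ->
  noise_on G B e b C K -> G A -> A `<=` B ->
  mx_measurable_wrt G u -> (forall w, enorm (u w) <= 1) ->
  \int[P]_(x in A) edot (u x) (e x) = 0.
Proof.
move=> sG GT GB ne GA AB mu u1.
have mA := GT _ GA; have mB := GT _ GB.
have muT : vmeasurable u by move=> i; exact: measurable_wrt_sub (mu i 0).
have h i : P.-integrable A (EFin \o (fun w => u w i 0 * e w i 0)).
  have := integrable_coord i ne mA mB AB => /integrable_norm Ii.
  apply: integrable_le Ii => //.
    by apply: measurable_funM => //; exact: (noise_measurable ne).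
  move=> w _; rewrite normrM -[leRHS]mul1r ler_wpM2r//.
  exact: le_trans (coord_le_enorm _ _) (u1 w).
have [_ ->] := Rintegral_sum (index_enum _) mA h.
apply: big1 => i _; apply: (Rintegral_mul_eq0 sG GT GA) => //.
- exact: integrable_coord ne _ _ _.
- exact: (noise_measurable ne).
- by move=> D GD DA; apply: (noise_mean ne) => //; exact: subset_trans AB.
- by move=> w; exact: le_trans (coord_le_enorm _ _) (u1 w).
Qed.

Lemma measurable_trunc_sqr K (e : T -> 'cV[R]_m) : vmeasurable e ->
  measurable_fun [set: T] (fun w => trunc_sqr K (e w)).
Proof.
move=> me; apply: measurable_fun_ifT.
- apply: measurable_fun_ler => //; exact: measurable_enorm.
- exact: measurable_edot.
- exact: measurable_cst.
Qed.

Lemma trunc_sqr_ge0 K (v : 'cV[R]_m) : 0 <= trunc_sqr K v.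
Proof. by rewrite /trunc_sqr; case: ifP => //; rewrite edot_ge0. Qed.

Lemma trunc_sqr_le K (v : 'cV[R]_m) : trunc_sqr K v <= edot v v.
Proof. by rewrite /trunc_sqr; case: ifP => //; rewrite edot_ge0. Qed.

(** The factor [k] lets one statement serve inside the unit ball, where it is 1 / (8 (2 + K)), and
    outside, where it is 0. *)
Lemma Rintegral_pot_gain G B e b C K A (y : T -> 'cV[R]_m) M t k :
  1 <= M -> 0 <= k ->
  sigma_algebra setT G -> G `<=` measurable -> G B ->
  noise_on G B e b C K -> G A -> A `<=` B -> mx_measurable_wrt G y ->
  (forall w, A w -> pot M (y w) + t * edot (dpot M (y w)) (e w)
      - t ^+ 2 / (4 * M) * edot (e w) (e w) + t ^+ 2 * k * trunc_sqr K (e w)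
    <= pot M (y w + t *: e w)) ->
  \int[P]_(x in A) pot M (y x) + t ^+ 2 * (k * b - C / (4 * M)) * pr P A
    <= \int[P]_(x in A) pot M (y x + t *: e x).
Proof.
move=> M1 k0 sG GT GB ne GA AB my step.
have mA := GT _ GA; have mB := GT _ GB; have me := noise_measurable ne.
have myT : vmeasurable y by move=> i; exact: measurable_wrt_sub (my i 0).
have mte : vmeasurable (fun w => y w + t *: e w).
  by apply: vmeasurableD => //; exact: vmeasurableZ.
have Ib (z : T -> 'cV[R]_m) : vmeasurable z ->
    P.-integrable A (EFin \o (fun w => pot M (z w))).
  move=> mz; apply: integrable_bounded (measurable_pot M mz) _ => //.
  by move=> w _; rewrite ger0_norm ?pot_ge0//; exact: pot_le.
have I2 : P.-integrable A (EFin \o (fun w => edot (e w) (e w))).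
  exact: integrableS AB (noise_integrable ne).
have I3 : P.-integrable A (EFin \o (fun w => trunc_sqr K (e w))).
  apply: integrable_le I2 => //; first exact: measurable_trunc_sqr.
  by move=> w _; rewrite ger0_norm ?trunc_sqr_ge0// trunc_sqr_le.
have u1 w : enorm (dpot M (y w)) <= 1 by exact: enorm_dpot.
have I1 : P.-integrable A (EFin \o (fun w => edot (dpot M (y w)) (e w))).
  by apply: integrable_edot ne _ _ _ _ _ => //; exact: vmeasurable_dpot.
have J1 := integrableZl mA t I1.
have J2 := integrableZl mA (- (t ^+ 2 / (4 * M))) I2.
have J3 := integrableZl mA (t ^+ 2 * k) I3.
have K1 := integrableD mA (Ib _ myT) J1.
have K2 := integrableD mA K1 J2.
have K3 := integrableD mA K2 J3.
apply: le_trans (le_Rintegral (f1 := fun w => pot M (y w)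
  + t * edot (dpot M (y w)) (e w) + - (t ^+ 2 / (4 * M)) * edot (e w) (e w)
  + t ^+ 2 * k * trunc_sqr K (e w)) mA K3 (Ib _ mte) _); last first.
  by move=> w Aw; apply: le_trans (step w Aw); rewrite mulNr.
rewrite (RintegralD mA K2 J3) (RintegralD mA K1 J2) (RintegralD mA (Ib _ myT)
  J1).
rewrite !RintegralZl//.
rewrite (Rintegral_edot_eq0 sG GT GB ne GA AB) ?mulr0 ?addr0//; last first.
  move=> i j; rewrite (ord1 j).
  exact: (vmeasurable_dpot M (T := g_sigma_algebraType G) (fun i => my i 0)).
have U := noise_upper ne GA AB; have L := noise_lower ne GA AB.
rewrite -addrA lerD2l mulNr addrC.
have t2 : 0 <= t ^+ 2 by exact: sqr_ge0.
have M4 : 0 <= t ^+ 2 / (4 * M) by rewrite divr_ge0//; lra.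
have -> : t ^+ 2 * (k * b - C / (4 * M)) * pr P A =
  t ^+ 2 * k * (b * pr P A) - t ^+ 2 / (4 * M) * (C * pr P A) by field; lra.
apply: lerB; apply: ler_wpM2l => //; exact: mulr_ge0.
Qed.

Lemma Rintegral_pot_step G B e b C K (y : T -> 'cV[R]_m) M t :
  1 <= M -> 0 <= K -> 0 <= t <= 1 ->
  sigma_algebra setT G -> G `<=` measurable -> G B ->
  noise_on G B e b C K -> mx_measurable_wrt G y ->
  \int[P]_(x in B) pot M (y x)
    + t ^+ 2 * (b / (8 * (2 + K)) * pr P (B `&` [set w | enorm (y w) <= 1])
                - C / (4 * M) * pr P B)
    <= \int[P]_(x in B) pot M (y x + t *: e x).
Proof.
move=> M1 K0 /andP[t0 t1] sG GT GB ne my.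
have mB := GT _ GB; have me := noise_measurable ne.
have myT : vmeasurable y by move=> i; exact: measurable_wrt_sub (my i 0).
have mte : vmeasurable (fun w => y w + t *: e w).
  by apply: vmeasurableD => //; exact: vmeasurableZ.
have Ib (z : T -> 'cV[R]_m) : vmeasurable z ->
    P.-integrable B (EFin \o (fun w => pot M (z w))).
  move=> mz; apply: integrable_bounded (measurable_pot M mz) _ => //.
  by move=> w _; rewrite ger0_norm ?pot_ge0//; exact: pot_le.
set D := [set w | enorm (y w) <= 1].
have GD : G D.
  rewrite (_ : D = (fun w => enorm (y w)) @^-1` [set` `]-oo, 1]]); last first.
    by apply/seteqP; split => w /=; rewrite in_itv.
  apply: (sub_preimage sG) => //.
  exact: (measurable_enorm (T := g_sigma_algebraType G) (fun i => my i 0)).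
have mD := GT _ GD.
rewrite (Rintegral_setID mB mD (Ib _ mte)) (Rintegral_setID mB mD (Ib _ myT)).
rewrite (pr_setID P mB mD).
have h1 := @Rintegral_pot_gain G B e b C K (B `&` D) y M t (1 / (8 * (2 + K)))
  M1 _ sG GT GB ne (sub_setI sG GB GD) _ my _.
have h2 := @Rintegral_pot_gain G B e b C K (B `\` D) y M t 0
  M1 _ sG GT GB ne (sub_setD sG GB GD) _ my _.
have sq (w : T) : edot (t *: e w) (t *: e w) = t ^+ 2 * edot (e w) (e w).
  by rewrite edotZl edotZr; ring.
have {}h1 : \int[P]_(x in B `&` D) pot M (y x) + t ^+ 2 *
    (1 / (8 * (2 + K)) * b - C / (4 * M)) * pr P (B `&` D) <=
    \int[P]_(x in B `&` D) pot M (y x + t *: e x).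
  apply: h1; first by rewrite divr_ge0//; lra.
    by move=> w [].
  move=> w [_ Dw]; rewrite /trunc_sqr; case: ifPn => eK.
    (* Here t <= 1 matters: the truncation level of the noise also bounds the rescaled increment. *)
    have teK : enorm (t *: e w) <= K.
      by rewrite enormZ ger0_norm//; have := enorm_ge0 (e w); nra.
    apply: le_trans (potD_gain M1 Dw teK).
    rewrite edotZr sq le_eqVlt; apply/orP; left; apply/eqP.
    by field; rewrite !gt_eqF//; lra.
  apply: le_trans (potD_ge M1 _ _).
  rewrite edotZr sq mulr0 addr0 le_eqVlt; apply/orP; left; apply/eqP.
  by field; rewrite gt_eqF//; lra.
have {}h2 : \int[P]_(x in B `\` D) pot M (y x) + t ^+ 2 *
    (0 * b - C / (4 * M)) * pr P (B `\` D) <=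
    \int[P]_(x in B `\` D) pot M (y x + t *: e x).
  apply: h2 => //.
  move=> w _; apply: le_trans (potD_ge M1 _ _).
  rewrite edotZr sq mulr0 mul0r addr0 le_eqVlt; apply/orP; left; apply/eqP.
  by field; rewrite gt_eqF//; lra.
apply: le_trans (lerD h1 h2); rewrite le_eqVlt; apply/orP; left; apply/eqP.
by field; rewrite !gt_eqF//; lra.
Qed.

End one_step.

(** * The non-convergence argument *)

(* Either every [q i] is at least [p / 2] and the gains add up, or some [W i]
   is already large and the losses after it are small. *)
Lemma escape_lower_bound (R : realType) (V W q beta t : nat -> R)
    (g eps p L mu h : R) (n : nat) :
  0 <= p -> 0 <= g -> 0 <= eps -> 0 <= L -> mu <= 1 / 20 -> mu <= g / 4 ->
  (forall i, 0 <= t i) -> (forall i, 0 <= q i) ->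
  (forall i, \sum_(j < i) t j <= 1) -> 1 / 2 <= \sum_(j < n) t j ->
  (forall i, p - h <= beta i <= p) -> 0 <= V 0%N ->
  (forall i, V i <= W i) ->
  (forall i, W i + t i * (g * q i - eps * p) - L * (beta i - beta i.+1)
    <= V i.+1) ->
  (forall i, q i < p / 2 -> p / 20 <= W i) ->
  mu * p - eps * p - L * h <= V n.
Proof.
move=> p0 g0 eps0 L0 mu1 mu2 t0 q0 S1 Sn bp V0 VW step far.
(* Both losses are compensated, the curvature loss through the elapsed time and the loss of mass
   through a telescoping term. Thus [U] is nondecreasing, and a large value reached once is never
   forgotten. *)
pose U i := V i + eps * p * \sum_(j < i) t j - L * beta i.
have US i : W i + eps * p * \sum_(j < i) t j - L * beta i + t i * (g * q i)
    <= U i.+1.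
  by rewrite /U big_ord_recr/=; have := step i; lra.
have tq i : 0 <= t i * (g * q i) by rewrite !mulr_ge0.
have U1 i : U i + t i * (g * q i) <= U i.+1.
  by apply: le_trans (US i); rewrite lerD2r !lerD2r VW.
have Umono i j : (i <= j)%N -> U i <= U j.
  move=> /subnK <-; elim: (j - i)%N => // l IH; rewrite addSn.
  by apply: le_trans IH _; apply: le_trans (U1 _); rewrite lerDl.
have ep0 : 0 <= eps * p by rewrite mulr_ge0.
have Lb i : L * (beta i - beta n) <= L * h.
  by rewrite ler_wpM2l//; have := bp i; have := bp n; lra.
have St i : 0 <= \sum_(j < i) t j by exact: sumr_ge0.
have [[j [jn qj]]|near] := pselect (exists j, (j < n)%N /\ q j < p / 2).
  have := Umono _ _ jn; have := US j; rewrite /U.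
  have := far _ qj; have := tq j; have := Lb j.
  have : eps * p * (\sum_(j < n) t j - \sum_(i < j) t i) <= eps * p.
    by rewrite -[leRHS]mulr1 ler_wpM2l//; have := St j; have := S1 n; lra.
  have : mu * p <= p / 20 by nra.
  by lra.
have Ug i : (i <= n)%N -> U 0%N + g * (p / 2) * \sum_(j < i) t j <= U i.
  elim: i => [|i IH] ni; first by rewrite big_ord0 mulr0 addr0.
  apply: le_trans (U1 i);
    rewrite big_ord_recr/= mulrDr addrA lerD ?IH ?(ltnW ni)//.
  have qi : p / 2 <= q i by rewrite leNgt; apply/negP => qi; apply: near;
    exists i.
  by rewrite mulrC ler_wpM2l// ler_wpM2l.
have := Ug _ (leqnn n); rewrite /U big_ord0 mulr0 addr0.
have := Lb 0%N.
have : eps * p * \sum_(j < n) t j <= eps * p.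
  by rewrite -[leRHS]mulr1 ler_wpM2l.
have : mu * p <= g * (p / 2) * \sum_(j < n) t j.
  apply: le_trans (_ : g * (p / 2) * (1 / 2) <= _); first by nra.
  by rewrite ler_wpM2l// !mulr_ge0//; lra.
by lra.
Qed.

(** Here s^2 is the sum of the squares remaining after [n0], positive because [c] does not vanish
    eventually. With c_k^2 / s^2 as the duration of step k, the time left is 1, and half of it
    elapses in finitely many steps. *)
Lemma tail_sqr (R : realType) (c : nat -> R) :
  (forall N, exists n, (N <= n)%N /\ c n != 0) ->
  cvgn [series c n ^+ 2]_n -> forall n0, exists2 s, 0 < s &
  (forall n, \sum_(j < n) c (n0 + j).+1 ^+ 2 <= s ^+ 2) /\
  exists n1, forall n, (n1 <= n)%N ->
    s ^+ 2 / 2 <= \sum_(j < n) c (n0 + j).+1 ^+ 2.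
Proof.
move=> c_io cvgc n0; set S := series _ in cvgc; set l := limn S.
have Smono : nondecreasing_seq S.
  by apply/nondecreasing_seqP => n;
    rewrite /S !seriesEnat/= big_nat_recr//= lerDl sqr_ge0.
have Sl n : S n <= l by exact: nondecreasing_cvgn_le.
have SE n : \sum_(j < n) c (n0 + j).+1 ^+ 2 = S (n0.+1 + n)%N - S n0.+1.
  elim: n => [|n IH]; first by rewrite big_ord0 addn0 subrr.
  rewrite big_ord_recr/= IH addnS /S [in RHS]seriesEnat/= big_nat_recr//=.
  by rewrite [in LHS]seriesEnat/= addrAC.
have l0 : 0 < l - S n0.+1.
  have [n [n0n cn]] := c_io n0.+1.
  rewrite subr_gt0; apply: lt_le_trans (Sl n.+1).
  apply: le_lt_trans (Smono _ _ n0n) _.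
  by rewrite /S !seriesEnat/= big_nat_recr//= ltrDl exprn_even_gt0.
exists (Num.sqrt (l - S n0.+1)); first by rewrite sqrtr_gt0.
rewrite sqr_sqrtr ?ltW//; split => [n|]; first by rewrite SE lerD2r.
have /cvgrPdist_lt /(_ ((l - S n0.+1) / 2)) := cvgc.
case; first by rewrite divr_gt0.
move=> n1 _ h; exists n1 => n n1n.
have := h (n0.+1 + n)%N (leq_trans n1n (leq_addl _ _)).
rewrite SE -/l ger0_norm ?subr_ge0//; lra.
Qed.

Section nonconvergence.
Context d (T : measurableType d) (R : realType) (P : probability T R) (m : nat).
Variables (F : nat -> set (set T)) (c : nat -> R)
  (X Y e r : nat -> T -> 'cV[R]_m) (Good : nat -> set T) (b C K : R) (N : nat).

(* An eighth of the smaller of the two possible gains per unit of probability: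
   1/20 for leaving the unit ball (a quarter of the mass, where the potential is
   at least 1/5), and g/4 for staying inside (half of the mass during at least
   half of the time, at rate g = b / (8 (2 + K))). *)
Definition slack : R := Num.min (1 / 20) (b / (8 * (2 + K)) / 4) / 8.

(* Convergence of [X] to 0 written with countable operations, so that it can be
   approximated by events of the filtration. *)
Definition tends0 : set T :=
  \bigcap_i \bigcup_n \bigcap_k
    [set w | (n <= k)%N -> enorm (X k w) <= i.+1%:R^-1].

Hypotheses (FF : filtration F) (c_ge0 : forall n, 0 <= c n)
  (c_io : forall N, exists n, (N <= n)%N /\ c n != 0)
  (c_cvg : cvgn [series c n ^+ 2]_n)
  (mX : forall k, mx_measurable_wrt (F k) (X k))
  (mY : forall k, mx_measurable_wrt (F k) (Y k))
  (mr : forall k, vmeasurable (r k))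
  (b_gt0 : 0 < b) (C_ge0 : 0 <= C) (K_ge0 : 0 <= K)
  (GoodF : forall k, (N <= k)%N -> F k (Good k))
  (recursion : forall k w, (N <= k)%N -> Good k.+1 w ->
    X k.+1 w = Y k w + c k.+1 *: (e k.+1 w + r k.+1 w))
  (expansion : forall k w, (N <= k)%N -> Good k w ->
    enorm (X k w) <= enorm (Y k w))
  (r_small : forall k w, (N <= k)%N -> Good k w ->
    \sum_(N <= j < k) enorm (r j.+1 w) ^+ 2 <= slack ^+ 2)
  (noise : forall k, (N <= k)%N ->
    noise_on P (F k) (Good k) (e k.+1) b C K).

Let sF n : sigma_algebra setT (F n). Proof. by case: FF. Qed.
Let mF n : F n `<=` measurable. Proof. by case: FF. Qed.
Let leF i j A : (i <= j)%N -> F i A -> F j A.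
Proof. by case: FF => _ _ h /h; exact. Qed.

Let vX k : vmeasurable (X k).
Proof.
move=> i; exact: (measurable_wrt_sub (sF k) (@mF k) (@mX k i 0)).
Qed.
Let vY k : vmeasurable (Y k).
Proof.
move=> i; exact: (measurable_wrt_sub (sF k) (@mF k) (@mY k i 0)).
Qed.

Let slack_gt0 : 0 < slack.
Proof.
have K0 := K_ge0; have b0 := b_gt0.
rewrite divr_gt0// lt_min; apply/andP; split; first lra.
by rewrite !divr_gt0// mulr_gt0//; lra.
Qed.

Definition trapped : set T :=
  (\bigcap_k [set w | (N <= k)%N -> Good k w]) `&` tends0.

(** Each [Good k] and each condition on [X k] lies in [F k], and [trapped] arises from them by
    countable operations. *)
Lemma approximable_trapped : approximable P F trapped.
Proof.
apply: approximableI => //.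
  apply: approximable_bigcap => // k.
  have [Nk|Nk] := boolP (N <= k)%N; last first.
    rewrite (_ : [set _ | _] = setT).
      by apply: (approximable_sub P FF (n := 0%N)); exact: sub_setT.
    by apply/seteqP; split.
  rewrite (_ : [set _ | _] = Good k).
    by apply: (approximable_sub P FF (n := k)); exact: GoodF.
  by apply/seteqP; split => w //=; exact.
apply: approximable_bigcap => // i; apply: approximable_bigcup => // n.
apply: approximable_bigcap => // k.
have [nk|nk] := boolP (n <= k)%N; last first.
  rewrite (_ : [set _ | _] = setT).
    by apply: (approximable_sub P FF (n := 0%N)); exact: sub_setT.
  by apply/seteqP; split.
apply: (approximable_sub P FF (n := k)).
rewrite (_ : [set _ | _] = (fun w => enorm (X k w)) @^-1` [set` `]-oo,
  i.+1%:R^-1]]).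
  apply: (sub_preimage (sF k)) => //.
  exact: (measurable_enorm (T := g_sigma_algebraType (F k)) (fun i =>
    @mX k i 0)).
by apply/seteqP; split => w /=; rewrite in_itv/=; [exact|].
Qed.

(** * The rescaled process started at time [n0] on an event [A] *)

Section stage.
Variables (n0 : nat) (A : set T) (s M : R).
Hypotheses (Nn0 : (N <= n0)%N) (FA : F n0 A) (s_gt0 : 0 < s) (M_ge1 : 1 <= M)
  (sum_s : forall n, \sum_(j < n) c (n0 + j).+1 ^+ 2 <= s ^+ 2).

Let x i w := s^-1 *: X (n0 + i) w.
Let y i w := s^-1 *: Y (n0 + i) w.
Let t i := c (n0 + i).+1 / s.
(** Added to the potential below: it grows by exactly as much as the i-th remainder can take from a
    1-Lipschitz function, so the remainders produce no loss in the recursion. *)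
Let rho i w := \sum_(j < i) t j * enorm (r (n0 + j).+1 w).

(** The part of [A] on which [Good] has not failed so far. The noise is controlled only there, and
    unlike [trapped] this event is known at time n0 + i. *)
Fixpoint running i : set T :=
  if i is i'.+1 then running i' `&` Good (n0 + i) else A `&` Good (n0 + 0).

Let B := running.

Let Nk i : (N <= n0 + i)%N. Proof. exact: leq_trans Nn0 (leq_addr _ _). Qed.

Lemma running_F i : F (n0 + i) (running i).
Proof.
elim: i => [|i IH] /=.
  by apply: sub_setI; [exact: sF|rewrite addn0|exact: GoodF].
by apply: sub_setI; [exact: sF|apply: leF IH; rewrite addnS|exact: GoodF].
Qed.

Let FB i : F (n0 + i) (B i). Proof. exact: running_F. Qed.
Let mB i : measurable (B i). Proof. exact: mF (FB i). Qed.

Let mA : measurable A. Proof. exact: mF FA. Qed.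

Let B_Good i : B i `<=` Good (n0 + i).
Proof. by case: i => [|i] w []. Qed.

Let B_dec i : B i.+1 `<=` B i.
Proof. by move=> w []. Qed.

Lemma running_sub i : running i `<=` A.
Proof. by elim: i => [|i IH] w [] // /IH. Qed.
Let B_A i : B i `<=` A. Proof. exact: running_sub. Qed.

Lemma trapped_running i : A `&` trapped `<=` running i.
Proof.
move=> w [Aw [Gw _]]; elim: i => [|i IH]; split => //; exact: (Gw _ I).
Qed.

Let t_ge0 i : 0 <= t i. Proof. by rewrite divr_ge0// ltW. Qed.

Let sum_t i : \sum_(j < i) t j ^+ 2 <= 1.
Proof.
under eq_bigr do rewrite /t expr_div_n.
by rewrite -mulr_suml ler_pdivrMr ?mul1r ?exprn_gt0.
Qed.

Let t_le1 i : t i <= 1.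
Proof.
rewrite -(ler_pXn2r (n := 2)) ?nnegrE// expr1n.
apply: le_trans (sum_t i.+1); rewrite big_ord_recr/= lerDr.
by apply: sumr_ge0 => j _; exact: sqr_ge0.
Qed.

Let rho_ge0 i w : 0 <= rho i w.
Proof. by apply: sumr_ge0 => j _; rewrite mulr_ge0 ?enorm_ge0. Qed.

Let rho_le i w : B i w -> rho i w <= slack.
Proof.
move=> Bw; have rs := r_small (Nk i) (B_Good Bw); have sl := slack_gt0.
have {}rs : \sum_(j < i) enorm (r (n0 + j).+1 w) ^+ 2 <= slack ^+ 2.
  apply: le_trans rs.
  elim: i {Bw} => [|i IH].
    by rewrite big_ord0; apply: sumr_ge0 => j _; exact: sqr_ge0.
  by rewrite big_ord_recr/= addnS big_nat_recr//= lerD2r.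
(* AM-GM: t v <= slack t^2 / 2 + v^2 / (2 slack) *)
apply: le_trans (_ : \sum_(j < i) (slack / 2 * t j ^+ 2 +
    (2 * slack)^-1 * enorm (r (n0 + j).+1 w) ^+ 2) <= _).
  apply: ler_sum => j _; set u := t j; set v := enorm _.
  rewrite -subr_ge0 (_ : _ - _ = (slack * u - v) ^+ 2 / (2 * slack)).
    by rewrite divr_ge0 ?sqr_ge0//; lra.
  by field; rewrite gt_eqF.
rewrite big_split/= -!mulr_sumr.
have h1 : slack / 2 * \sum_(j < i) t j ^+ 2 <= slack / 2 * 1.
  by rewrite ler_wpM2l ?sum_t//; lra.
have h2 : (2 * slack)^-1 * \sum_(j < i) enorm (r (n0 + j).+1 w) ^+ 2
    <= (2 * slack)^-1 * slack ^+ 2.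
  by rewrite ler_wpM2l// invr_ge0; lra.
have h3 : (2 * slack)^-1 * slack ^+ 2 = slack / 2 by field; rewrite gt_eqF.
by lra.
Qed.

Let slack_le1 : slack <= 1.
Proof.
rewrite ler_pdivrMr// ge_min; apply/orP; left; lra.
Qed.

Let measurable_rho i : measurable_fun [set: T] (rho i).
Proof.
apply: measurable_sum => j; apply: measurable_funM => //.
exact: measurable_enorm.
Qed.

Let Ipot i D (z : T -> 'cV[R]_m) : measurable D -> D `<=` B i ->
  vmeasurable z ->
  P.-integrable D (EFin \o (fun w => pot M (z w) + rho i w)).
Proof.
move=> mD DB mz; have M1 := M_ge1.
apply: (@integrable_bounded _ _ _ _ _ _ (M + 1)) => //.
  by apply: measurable_funD => //; exact: measurable_pot.
move=> w /DB Bw; rewrite ger0_norm;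
  last exact: addr_ge0 (pot_ge0 M1 _) (rho_ge0 _ _).
exact: lerD (pot_le M1 _) (le_trans (rho_le Bw) slack_le1).
Qed.

Let Ipot0 D (z : T -> 'cV[R]_m) : measurable D -> vmeasurable z ->
  P.-integrable D (EFin \o (fun w => pot M (z w))).
Proof.
move=> mD mz; have M1 := M_ge1.
apply: (@integrable_bounded _ _ _ _ _ _ M) => //; first exact: measurable_pot.
by move=> w _; rewrite ger0_norm ?pot_ge0// pot_le.
Qed.

Let Irho i D : measurable D -> D `<=` B i -> P.-integrable D (EFin \o rho i).
Proof.
move=> mD DB; apply: (@integrable_bounded _ _ _ _ _ _ 1) => //.
by move=> w /DB Bw; rewrite ger0_norm//; exact: le_trans (rho_le Bw) slack_le1.
Qed.

(** The drift leads from [inner i] to [outer i] and the noise from there to [inner i.+1]; the former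
    cannot decrease the value, by radial monotonicity alone. *)
Definition inner i : R := \int[P]_(w in B i) (pot M (x i w) + rho i w).
Definition outer i : R := \int[P]_(w in B i) (pot M (y i w) + rho i w).
Definition central i : R := pr P (B i `&` [set w | enorm (y i w) <= 1]).

Let vx i : vmeasurable (x i).
Proof. exact: vmeasurableZ. Qed.
Let vy i : vmeasurable (y i).
Proof. exact: vmeasurableZ. Qed.

Lemma inner_le_outer i : inner i <= outer i.
Proof.
have M1 := M_ge1.
apply: le_Rintegral => //; try exact: Ipot.
move=> w Bw; rewrite lerD2r le_pot// !enormZ ler_wpM2l//.
exact: expansion (Nk i) (B_Good Bw).
Qed.

(* Passing from [B i] to [B i.+1] costs at most [M + 1] times the probability
   that is lost, because the potential plus [rho] is bounded by [M + 1]. *)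
Lemma inner_step i :
  outer i + t i ^+ 2 * (b / (8 * (2 + K)) * central i - C / (4 * M) * pr P A)
    - (M + 1) * (pr P (B i) - pr P (B i.+1)) <= inner i.+1.
Proof.
have M1 := M_ge1; have C0 := C_ge0.
have GB : noise_on P (F (n0 + i)) (B i) (e (n0 + i).+1) b C K.
  have [h1 h2 h3 h4 h5] := noise (Nk i).
  have BG := @B_Good i.
  split => //.
  - by apply: integrableS BG h2 => //; apply: mF (GoodF (Nk i)).
  - by move=> j D FD DB; apply: h3 => //; exact: subset_trans BG.
  - by move=> D FD DB; apply: h4 => //; exact: subset_trans BG.
  - by move=> D FD DB; apply: h5 => //; exact: subset_trans BG.
have ve := noise_measurable GB.
have my : mx_measurable_wrt (F (n0 + i)) (y i).
  move=> j l; rewrite (ord1 l).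
  apply: (@vmeasurableZ _ _ _ (g_sigma_algebraType (F (n0 + i))) (fun=> s^-1))
    => //.
  by move=> j'; exact: (@mY _ _ 0).
have tt : 0 <= t i <= 1 by rewrite t_ge0 t_le1.
have := Rintegral_pot_step M1 K_ge0 tt (sF (n0 + i)) (@mF (n0 + i)) (FB i) GB
  my.
set z := fun w => y i w + t i *: e (n0 + i).+1 w.
have vz : vmeasurable z by apply: vmeasurableD => //; exact: vmeasurableZ.
rewrite -/(central i) => step.
have E1 : outer i = \int[P]_(w in B i) pot M (y i w) + \int[P]_(w in B i) rho i
  w.
  by rewrite /outer RintegralD//; [exact: Ipot0|exact: Irho].
have E2 : \int[P]_(w in B i) (pot M (z w) + rho i w) =
    \int[P]_(w in B i) pot M (z w) + \int[P]_(w in B i) rho i w.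
  by rewrite RintegralD//; [exact: Ipot0|exact: Irho].
have E3 := Rintegral_setID (mB i) (mB i.+1) (Ipot (mB i) (@subset_refl _ _) vz).
have BB : B i `&` B i.+1 = B i.+1 by apply/setIidPr; exact: B_dec.
rewrite BB in E3.
have h1 : \int[P]_(w in B i.+1) (pot M (z w) + rho i w) <= inner i.+1.
  apply: le_Rintegral => //; [exact: Ipot|exact: Ipot|].
  move=> w Bw; have xE : x i.+1 w = z w + t i *: r (n0 + i).+1 w.
    rewrite /x addnS (recursion (Nk i)); last by rewrite -addnS; exact: B_Good.
    by rewrite /z /y /t scalerDr scalerA mulrC !scalerDr addrA.
  have -> : rho i.+1 w = rho i w + t i * enorm (r (n0 + i).+1 w).
    by rewrite /rho big_ord_recr.
  (* Read backwards, from the new state to [z]: removing the remainder raises the potential by at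
     most t |r|, the increment of [rho]. *)
  have := pot_lipschitz M1 (x i.+1 w) (- (t i *: r (n0 + i).+1 w)).
  rewrite {1}xE addrK -scaleNr enormZ normrN ger0_norm//; lra.
have mD : measurable (B i `\` B i.+1) by exact: measurableD.
have h2 : \int[P]_(w in B i `\` B i.+1) (pot M (z w) + rho i w)
    <= (M + 1) * pr P (B i `\` B i.+1).
  rewrite -Rintegral_pr//; apply: le_Rintegral => //.
  - by apply: Ipot => //; exact: subDsetl.
  - exact: finite_measure_integrable_cst.
  - move=> w [Bw _].
    exact: lerD (pot_le M1 _) (le_trans (rho_le Bw) slack_le1).
have h3 := pr_setID P (mB i) (mB i.+1); rewrite BB in h3.
have h4 : t i ^+ 2 * (C / (4 * M) * pr P (B i)) <= t i ^+ 2 * (C / (4 * M) * pr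
  P A).
  rewrite ler_wpM2l ?sqr_ge0// ler_wpM2l ?divr_ge0//; first lra.
  by apply: le_pr => //; exact: B_A.
move: step h2; rewrite mulrBr => step h2.
have -> : pr P (B i) - pr P (B i.+1) = pr P (B i `\` B i.+1) by lra.
rewrite mulrBr; lra.
Qed.

Lemma outer_far i : central i < pr P A / 2 -> 3 / 4 * pr P A <= pr P (B i) ->
  pr P A / 20 <= outer i.
Proof.
move=> near pB; have M1 := M_ge1.
set D := [set w | enorm (y i w) <= 1].
have mD : measurable D.
  rewrite (_ : D = (fun w => enorm (y i w)) @^-1` [set` `]-oo, 1]]); last first.
    by apply/seteqP; split => w /=; rewrite in_itv.
  by rewrite -[X in measurable X]setTI; exact: measurable_enorm.
have mBD : measurable (B i `\` D) by exact: measurableD.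
have := pr_setID P (mB i) mD; rewrite -/(central i) => pBD.
rewrite /outer (Rintegral_setID (mB i) mD); last exact: Ipot.
have h1 : 0 <= \int[P]_(w in B i `&` D) (pot M (y i w) + rho i w).
  by apply: Rintegral_ge0 => w _; exact: addr_ge0 (pot_ge0 M1 _) (rho_ge0 _ _).
have h2 : 1 / 5 * pr P (B i `\` D)
    <= \int[P]_(w in B i `\` D) (pot M (y i w) + rho i w).
  rewrite -Rintegral_pr//; apply: le_Rintegral => //.
  - exact: finite_measure_integrable_cst.
  - by apply: Ipot => //; exact: subDsetl.
  - move=> w [Bw /negP Dw]; rewrite -[leLHS]addr0; apply: lerD => //;
    apply: pot_ge => //.
    by rewrite ltW// ltNge.
lra.
Qed.

(** Off [D] the rescaled state and [rho] are both at most [slack]; on [D] only the bound M + slack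
    is available. In the application [D] has small probability. *)
Lemma inner_upper i D : measurable D -> (forall w, B i w -> ~ D w ->
  enorm (X (n0 + i) w) <= slack * s) ->
  inner i <= 2 * slack * pr P A + M * pr P (B i `&` D).
Proof.
move=> mD small; have M1 := M_ge1; have sl := slack_gt0.
have mBD : measurable (B i `&` D) by exact: measurableI.
have mBD' : measurable (B i `\` D) by exact: measurableD.
have sub1 : B i `&` D `<=` B i by exact: subIsetl.
have sub2 : B i `\` D `<=` B i by exact: subDsetl.
rewrite /inner (Rintegral_setID (mB i) mD); last exact: Ipot.
have h1 : \int[P]_(w in B i `&` D) (pot M (x i w) + rho i w)
    <= (M + slack) * pr P (B i `&` D).
  rewrite -Rintegral_pr//; apply: le_Rintegral => //; first exact: Ipot.
    exact: finite_measure_integrable_cst.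
  by move=> w [Bw _]; exact: lerD (pot_le M1 _) (rho_le Bw).
have h2 : \int[P]_(w in B i `\` D) (pot M (x i w) + rho i w)
    <= (2 * slack) * pr P (B i `\` D).
  rewrite -Rintegral_pr//; apply: le_Rintegral => //; first exact: Ipot.
    exact: finite_measure_integrable_cst.
  move=> w [Bw Dw]; rewrite mulrDl mul1r; apply: lerD (rho_le Bw).
  apply: le_trans (pot_le_enorm M1 _) _.
  rewrite enormZ ger0_norm; last by rewrite invr_ge0 ltW.
  by rewrite ler_pdivrMl// mulrC; exact: small.
have := pr_setID P (mB i) mD; have : pr P (B i) <= pr P A.
  by apply: le_pr => //; exact: B_A.
have := pr_ge0 P (B i `&` D).
move=> h3 h4 h5; rewrite !mulrDl; nra.
Qed.

End stage.

Lemma inner_ge0 n0 A s M i : 1 <= M -> 0 < s -> 0 <= inner n0 A s M i.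
Proof.
move=> M1 s0; apply: Rintegral_ge0 => w _; apply: addr_ge0;
  first exact: pot_ge0.
apply: sumr_ge0 => j _; apply: mulr_ge0 (enorm_ge0 _).
by rewrite divr_ge0// ltW.
Qed.

Theorem pr_trapped : pr P trapped = 0.
Proof.
have sl := slack_gt0; have b0 := b_gt0; have K0 := K_ge0; have C0 := C_ge0.
have mE : measurable trapped by case: approximable_trapped.
apply/eqP; rewrite eq_le pr_ge0 andbT leNgt; apply/negP => E0.
set g := b / (8 * (2 + K)); pose mu := 8 * slack.
have mu0 : 0 < mu by rewrite mulr_gt0.
have muE : mu = Num.min (1 / 20) (g / 4).
  by rewrite /mu /slack mulrC divfK// gt_eqF.
(* So that the total curvature loss C / (4M) is at most mu / 4. *)
pose M := Num.max 1 (C / mu).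
have M1 : 1 <= M by rewrite le_max lexx.
have CM : C <= mu * M.
  by rewrite mulrC -ler_pdivrMr// le_max lexx orbT.
(* Chosen after [M], since lost mass is weighted by M + 1 <= 2M: both (M + 1) eta and 2 M eta are at
   most mu / 16. *)
pose eta := mu / (32 * M).
have eta0 : 0 < eta by rewrite divr_gt0//; lra.
have etaM : eta * M = mu / 32 by rewrite /eta; field; rewrite gt_eqF//; lra.
have [n0 [A [Nn0 FA A0 AE]]] :=
  approximable_density FF N approximable_trapped E0 eta0.
have mA := mF FA.
have [s s0 [sum_s [n1 n1P]]] := tail_sqr c_io c_cvg n0.
set p := pr P A in A0 AE.
(* The trapped points at which the process still exceeds [slack * s] at some time from n0 + i on.
   These events decrease to the empty set because [trapped] lies in [tends0]. *)
pose D i := trapped `&` \bigcup_k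
  [set w | (i <= k)%N /\ slack * s < enorm (X (n0 + k) w)].
have mXk k : measurable [set w | slack * s < enorm (X k w)].
  rewrite (_ : [set _ | _] = (fun w => enorm (X k w)) @^-1` [set` `]slack * s,
    +oo[]).
    by rewrite -[X in measurable X]setTI; exact: measurable_enorm.
  by apply/seteqP; split => w /=; rewrite in_itv/= andbT.
have mD i : measurable (D i).
  apply: measurableI => //; apply: bigcupT_measurable => k.
  have [ik|ik] := boolP (i <= k)%N.
    rewrite (_ : [set _ | _] = [set w | slack * s < enorm (X (n0 + k) w)])//.
    by apply/seteqP; split => w //= [].
  rewrite (_ : [set _ | _] = set0)//.
  by apply/seteqP; split => w //= [].
have [||| N2 DN2] := @pr_nonincreasing_lt _ _ _ P D (eta * p) mD.
- move=> i w [Ew [k _ [ik Xk]]]; split => //; exists k => //; split => //.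
  exact: ltnW.
- rewrite -subset0 => w Dw; have [[_ Xw] _] := Dw 0%N I.
  have [j jP] : exists j : nat, j.+1%:R^-1 < slack * s.
    have ss : 0 < slack * s by rewrite mulr_gt0.
    exists (Num.truncn (slack * s)^-1).
    rewrite invf_plt ?posrE//; exact: truncnS_gt.
  have [k _ kP] := Xw j I.
  have [_ [l _ [kl]]] := Dw k I; rewrite ltNge => /negP; apply.
  apply: le_trans (ltW jP); apply: (kP (n0 + l)%N I) => /=.
  exact: leq_trans kl (leq_addl _ _).
- by rewrite mulr_gt0.
(* Late enough for half of the time to have elapsed and for the process to be small on most of
   [trapped]. *)
pose n := maxn n1 N2.
have pD : pr P (D n) < eta * p by apply: DN2; rewrite leq_maxr.
have mAE : measurable (A `\` trapped) by exact: measurableD.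
have mD' : measurable ((A `\` trapped) `|` D n) by exact: measurableU.
have mB i : measurable (running n0 A i) by exact: mF (running_F Nn0 FA i).
have up := inner_upper Nn0 FA s0 M1 sum_s (i := n) mD' _.
have {}up : inner n0 A s M n <= 2 * slack * p + M * (2 * (eta * p)).
  apply: le_trans (up _) _.
    move=> w Bw nD; rewrite leNgt; apply/negP => Xw; apply: nD.
    have [Ew|Ew] := pselect (trapped w).
      by right; split => //; exists n.
    by left; split => //; exact: running_sub Bw.
  rewrite lerD2l ler_wpM2l//; first lra.
  apply: le_trans (_ : pr P ((A `\` trapped) `|` D n) <= _).
    by apply: le_pr => //; exact: measurableI.
  apply: le_trans (pr_setU_le _ mAE (mD n)) _; lra.
have beta_bounds i : p - eta * p <= pr P (running n0 A i) <= p.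
  apply/andP; split; last by apply: le_pr => //; exact: running_sub.
  rewrite lerBlDr; apply: le_trans (lerD (lexx _) AE).
  apply: le_trans (pr_setU_le _ (mB i) mAE); apply: le_pr => //.
    exact: measurableU.
  move=> w Aw; have [Ew|Ew] := pselect (trapped w); last by right.
  by left; apply: trapped_running.
have g0 : 0 < g by rewrite divr_gt0//; lra.
have sum_t i : \sum_(j < i) (c (n0 + j).+1 / s) ^+ 2 =
    (\sum_(j < i) c (n0 + j).+1 ^+ 2) / s ^+ 2.
  by under eq_bigr do rewrite expr_div_n; rewrite mulr_suml.
have s20 : 0 < s ^+ 2 by rewrite exprn_gt0.
have low := @escape_lower_bound R (inner n0 A s M) (outer n0 A s M)
  (central n0 A s) (fun i => pr P (running n0 A i))
  (fun i => (c (n0 + i).+1 / s) ^+ 2) g (C / (4 * M)) p (M + 1) mu (eta * p) n.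
have {}low : mu * p - C / (4 * M) * p - (M + 1) * (eta * p) <= inner n0 A s M n.
  apply: low => //.
  - exact: ltW.
  - exact: ltW.
  - by rewrite divr_ge0//; lra.
  - lra.
  - by rewrite muE ge_min lexx.
  - by rewrite muE ge_min lexx orbT.
  - by move=> i; exact: sqr_ge0.
  - by move=> i; exact: pr_ge0.
  - by move=> i; rewrite sum_t ler_pdivrMr// mul1r.
  - rewrite sum_t ler_pdivlMr// mul1r mulrC; apply: n1P; exact: leq_maxl.
  - exact: inner_ge0.
  - by move=> i; exact: inner_le_outer.
  - by move=> i; exact: (inner_step Nn0 FA s0 M1 sum_s i).
  - move=> i qi; apply: (outer_far Nn0 FA s0 M1 sum_s) => //.
    have /andP[h _] := beta_bounds i; apply: le_trans h.
    (* Ensures that three quarters of the mass survive, as [outer_far] requires. *)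
    have : eta <= 1 / 4.
      rewrite -(ler_pM2r (_ : 0 < M)) ?etaM; last lra.
      have : mu <= 1 / 20 by rewrite muE ge_min lexx.
      lra.
    by rewrite /p in A0 *; nra.
have c4 : C / (4 * M) <= mu / 4.
  rewrite ler_pdivrMr; last lra.
  by have -> : mu / 4 * (4 * M) = mu * M by field.
(* The contradiction: the lower bound is at least (1 - 1/4 - 1/16) mu p = 11/16 mu p, the upper
   bound is (1/4 + 1/16) mu p = 5/16 mu p. *)
have := le_trans low up.
have muE' : slack = mu / 8 by rewrite /mu mulrC mulKf.
rewrite muE'.
have -> : M * (2 * (eta * p)) = 2 * (eta * M) * p by ring.
have : (M + 1) * (eta * p) <= 2 * (eta * M) * p.
  have -> : 2 * (eta * M) * p = (M + M) * (eta * p) by ring.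
  by apply: ler_wpM2r; [apply: ltW; exact: mulr_gt0|lra].
rewrite etaM; nra.
Qed.

End nonconvergence.

(** * A Lyapunov norm *)

Section complex_plane.
Context {R : realType}.
Implicit Types z w a : R[i].

(** The real part of z times the conjugate of w, that is, the scalar product of the plane. *)
Definition cdot z w : R :=
  complex.Re z * complex.Re w + complex.Im z * complex.Im w.

Lemma ReD z w : complex.Re (z + w) = complex.Re z + complex.Re w.
Proof. by case: z; case: w. Qed.

Lemma ImD z w : complex.Im (z + w) = complex.Im z + complex.Im w.
Proof. by case: z; case: w. Qed.

Lemma ReM z w : complex.Re (z * w) =
  complex.Re z * complex.Re w - complex.Im z * complex.Im w.
Proof. by case: z; case: w. Qed.

Lemma ImM z w : complex.Im (z * w) =
  complex.Re z * complex.Im w + complex.Im z * complex.Re w.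
Proof. by case: z; case: w. Qed.

Lemma Re_sum I (s : seq I) (Q : pred I) (f : I -> R[i]) :
  complex.Re (\sum_(i <- s | Q i) f i) = \sum_(i <- s | Q i) complex.Re (f i).
Proof. exact: (big_morph _ ReD). Qed.

Lemma Im_sum I (s : seq I) (Q : pred I) (f : I -> R[i]) :
  complex.Im (\sum_(i <- s | Q i) f i) = \sum_(i <- s | Q i) complex.Im (f i).
Proof. exact: (big_morph _ ImD). Qed.

Lemma cdot_suml I (s : seq I) (Q : pred I) (f : I -> R[i]) w :
  cdot (\sum_(i <- s | Q i) f i) w = \sum_(i <- s | Q i) cdot (f i) w.
Proof. by rewrite /cdot Re_sum Im_sum !mulr_suml -big_split. Qed.

Lemma cdot_ge0 z : 0 <= cdot z z.
Proof. by rewrite addr_ge0// -expr2 sqr_ge0. Qed.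

Lemma cdotMl a z : cdot (a * z) z = complex.Re a * cdot z z.
Proof. by rewrite /cdot ReM ImM; ring. Qed.

Lemma cdotM a z : cdot (a * z) (a * z) = cdot a a * cdot z z.
Proof. by rewrite /cdot ReM ImM; ring. Qed.

Lemma cdotM_ge (h : R) a z w : 0 <= h -> cdot a a <= h ^+ 2 ->
  - (h * (cdot z z + cdot w w) / 2) <= cdot (a * z) w.
Proof.
move=> h0 ah; have z0 := cdot_ge0 z; have w0 := cdot_ge0 w.
have cs : cdot (a * z) w ^+ 2 <= cdot (a * z) (a * z) * cdot w w.
  rewrite /cdot; set p := complex.Re (a * z); set q := complex.Im (a * z).
  set u := complex.Re w; set v := complex.Im w.
  rewrite -subr_ge0.
  have -> : (p * p + q * q) * (u * u + v * v) - (p * u + q * v) ^+ 2 =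
    (p * v - q * u) ^+ 2 by ring.
  exact: sqr_ge0.
rewrite cdotM in cs.
have {}cs : cdot (a * z) w ^+ 2 <= (h * (cdot z z + cdot w w) / 2) ^+ 2.
  apply: le_trans cs _.
  apply: le_trans (_ : h ^+ 2 * (cdot z z * cdot w w) <= _).
    by rewrite -mulrA ler_wpM2r// mulr_ge0.
  have -> : (h * (cdot z z + cdot w w) / 2) ^+ 2 =
    h ^+ 2 * ((cdot z z + cdot w w) / 2) ^+ 2 by field.
  apply: ler_wpM2l; first exact: sqr_ge0.
  rewrite -subr_ge0; set u := cdot z z; set v := cdot w w.
  have -> : ((u + v) / 2) ^+ 2 - u * v = ((u - v) / 2) ^+ 2 by field.
  exact: sqr_ge0.
have h2 : 0 <= h * (cdot z z + cdot w w) / 2.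
  by rewrite divr_ge0// mulr_ge0// addr_ge0.
have : `|cdot (a * z) w| <= h * (cdot z z + cdot w w) / 2.
  by rewrite -(ler_pXn2r (n := 2)) ?nnegrE// real_normK ?num_real.
by rewrite ler_norml => /andP[].
Qed.

End complex_plane.

Section lyapunov.
Context {R : realType}.

Lemma sum_trig_le d (f : 'I_d -> R) : (forall i, 0 <= f i) ->
  \sum_(i < d) \sum_(j < d | (j < i)%N) (f j + f i) / 2 <= d%:R * \sum_i f i.
Proof.
move=> f0; apply: le_trans (_ : \sum_(i < d) \sum_(j < d) (f j + f i) / 2 <= _).
  apply: ler_sum => i _;
    rewrite [leRHS](bigID (fun j : 'I_d => (j < i)%N))/= lerDl.
  by apply: sumr_ge0 => j _; rewrite divr_ge0// addr_ge0.
under eq_bigr do rewrite -mulr_suml big_split/= sumr_const card_ord.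
rewrite -mulr_suml big_split/= sumr_const card_ord sumrMnl -mulr_natl.
by rewrite -mulr_natl; lra.
Qed.

(** A diagonal-dominance estimate. Entries above the diagonal vanish, and by [cdotM_ge] each entry
    below costs at most h times the mean of two squared coordinates; at most d times the total is
    collected. *)
Lemma trig_coercive d (L : 'M[R[i]]_d) (lam h : R) (z : 'cV[R[i]]_d) :
  0 <= h -> is_trig_mx L -> (forall i, lam <= complex.Re (L i i)) ->
  (forall i j : 'I_d, (j < i)%N -> cdot (L i j) (L i j) <= h ^+ 2) ->
  (lam - h * d%:R) * \sum_i cdot (z i 0) (z i 0)
    <= \sum_i cdot ((L *m z) i 0) (z i 0).
Proof.
move=> h0 /is_trig_mxP Ltrig Ldiag Loff.
set S := \sum_i _.
apply: le_trans (_ : \sum_(i < d) (lam * cdot (z i 0) (z i 0) -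
  h * \sum_(j < d | (j < i)%N) (cdot (z j 0) (z j 0) + cdot (z i 0) (z i 0)) /
    2)
  <= _).
  rewrite sumrB -!mulr_sumr mulrBl lerB// -mulrA ler_wpM2l//.
  by apply: sum_trig_le => i; exact: cdot_ge0.
apply: ler_sum => i _; rewrite mxE cdot_suml.
rewrite [leRHS](bigID (fun j : 'I_d => (j < i)%N))/= [leRHS]addrC;
  apply: lerD; last first.
  rewrite mulr_sumr -sumrN; apply: ler_sum => j ji.
  by rewrite mulrA; exact/cdotM_ge/Loff.
rewrite (bigD1 i) ?ltnn//= big1 ?addr0; last first.
  move=> j /andP[ij ji]; rewrite Ltrig ?mul0r /cdot ?mul0r ?addr0//.
  by rewrite ltn_neqAle leqNgt ij eq_sym ji.
by rewrite cdotMl ler_wpM2r ?cdot_ge0.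
Qed.

(* Conjugating the triangular matrix by diag(t^i) multiplies its entry (i, j) by
   t^(i-j), so that for small [t] the diagonal dominates. *)
Lemma lyapunov d (H : 'M[R]_d) : repulsive H ->
  exists m (B : 'M[R]_(m, d)) (B' : 'M[R]_(d, m)) (lam : R),
    [/\ 0 < lam, B' *m B = 1%:M
      & forall x : 'cV[R]_d,
          lam * edot (B *m x) (B *m x) <= edot (B *m (H *m x)) (B *m x)].
Proof.
move=> Hrep; have [d0|d0] := posnP d.
  exists 0%N, 0, 0, 1; split => //.
    by apply/matrixP => i; exfalso; case: i => i; rewrite d0.
  by move=> x; rewrite /edot !big_ord0 mulr0.
pose A := map_mx (real_complex R) H.
have [U /unitarymx_unit Uu] := Schur A d0.
move=> UA; have Ltrig : is_trig_mx (U *m A *m invmx U) by rewrite -conjumx.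
set L := U *m A *m invmx U in Ltrig.
have LU : L *m U = U *m A by rewrite mulmxKV.
have Ldiag i : 0 < complex.Re (L i i).
  apply: Hrep; apply: (eigenvalue_conjmx (V := U)).
  - by rewrite submx_full// row_full_unit.
  - by rewrite row_free_unit.
  - rewrite conjumx//; change (eigenvalue L (L i i)).
    by rewrite eigenvalue_root_char char_poly_trig// (bigD1 i)//= rootM
      root_XsubC eqxx.
(* The neutral value 1 is harmless: only positivity and [lam <= Re (L i i)] are needed. *)
pose lam := \big[Order.min/1]_i complex.Re (L i i).
have lam0 : 0 < lam by apply: lt_bigmin.
have lam_le i : lam <= complex.Re (L i i) by apply: bigmin_le.
(* Off-diagonal entries of modulus at most [h] cost h d = lam / 2, which leaves half of [lam]. *)
pose h := lam / (2 * d%:R).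
have dR : 0 < d%:R :> R by rewrite ltr0n.
have h0 : 0 < h by rewrite divr_gt0// mulr_gt0.
pose N := \sum_i \sum_j cdot (L i j) (L i j).
have N0 : 0 <= N by do 2!(apply: sumr_ge0 => ? _); exact: cdot_ge0.
have LN i j : cdot (L i j) (L i j) <= N.
  rewrite /N (bigD1 i)//= (bigD1 j)//= -addrA lerDl addr_ge0//.
    by apply: sumr_ge0 => k _; exact: cdot_ge0.
  by do 2!(apply: sumr_ge0 => ? _); exact: cdot_ge0.
(* From t (1 + N) <= h follows t^2 N <= h^2, because N <= (1 + N)^2. *)
pose t := Num.min 1 (h / (1 + N)).
have N1 : 0 < 1 + N by lra.
have t0 : 0 < t by rewrite lt_min ltr01 divr_gt0.
have t1 : t <= 1 by rewrite ge_min lexx.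
have tN : t ^+ 2 * N <= h ^+ 2.
  have : t * (1 + N) <= h by rewrite -ler_pdivlMr// ge_min lexx orbT.
  move=> h1; have : (t * (1 + N)) ^+ 2 <= h ^+ 2.
    apply: lerXn2r => //; rewrite nnegrE; last exact: ltW.
    by apply: mulr_ge0; exact: ltW.
  rewrite exprMn; apply: le_trans; rewrite ler_wpM2l ?sqr_ge0//; nra.
pose tc := real_complex R t.
have tc0 : tc != 0 by rewrite /tc -(rmorph0 (real_complex R)) (inj_eq
  (fmorph_inj _)) gt_eqF.
pose D := \row_(i < d) tc ^+ i.
pose Q := diag_mx D *m U.
pose L' := \matrix_(i, j) (tc ^+ i * L i j / tc ^+ j).
have LD : L' *m diag_mx D = diag_mx D *m L.
  apply/matrixP => i j; rewrite mul_mx_diag mul_diag_mx !mxE.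
  by rewrite divfK// expf_neq0.
have LQ : L' *m Q = Q *m A by rewrite mulmxA LD -mulmxA LU mulmxA.
have Du : diag_mx D \in unitmx.
  rewrite unitmxE det_diag unitfE; apply/prodf_neq0 => i _.
  by rewrite mxE expf_neq0.
have Qu : Q \in unitmx by rewrite unitmx_mul Du.
have L'trig : is_trig_mx L'.
  apply/is_trig_mxP => i j ij; rewrite mxE.
  by move/is_trig_mxP : Ltrig => ->//; rewrite mulr0 mul0r.
have L'diag i : lam <= complex.Re (L' i i).
  by rewrite mxE mulrAC divff ?mul1r ?expf_neq0.
have L'off (i j : 'I_d) : (j < i)%N -> cdot (L' i j) (L' i j) <= h ^+ 2.
  move=> ji; rewrite mxE mulrAC -expfB// cdotM.
  apply: le_trans tN; rewrite ler_pM ?cdot_ge0//.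
  rewrite /tc -rmorphXn /cdot/= mulr0 addr0 -expr2.
  apply: lerXn2r; rewrite ?nnegrE ?exprn_ge0 ?(ltW t0)//.
  have : (0 < i - j)%N by rewrite subn_gt0.
  case: (i - j)%N => // k _; rewrite exprS -[leRHS]mulr1; apply: ler_wpM2l;
    first exact: ltW.
  by rewrite exprn_ile1 ?(ltW t0).
pose re p q (M : 'M[R[i]]_(p, q)) := map_mx (@complex.Re R) M.
pose im p q (M : 'M[R[i]]_(p, q)) := map_mx (@complex.Im R) M.
pose toC (x : 'cV[R]_d) := map_mx (real_complex R) x.
have reE (M : 'M[R[i]]_d) x i : (re _ _ M *m x) i 0 = complex.Re ((M *m toC x)
  i 0).
  rewrite !mxE Re_sum; apply: eq_bigr => j _.
  by rewrite !mxE ReM /= mulr0 subr0.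
have imE (M : 'M[R[i]]_d) x i : (im _ _ M *m x) i 0 = complex.Im ((M *m toC x)
  i 0).
  rewrite !mxE Im_sum; apply: eq_bigr => j _.
  by rewrite !mxE ImM /= mulr0 add0r.
(* Stacking real and imaginary parts makes |B x| the Hermitian length of Q x, so [B] is real with 2d
   rows. *)
pose B := col_mx (re _ _ Q) (im _ _ Q).
have BE x y : edot (B *m x) (B *m y) =
    \sum_i cdot ((Q *m toC x) i 0) ((Q *m toC y) i 0).
  rewrite /edot big_split_ord/= -big_split; apply: eq_bigr => i _ /=.
  by rewrite !mul_col_mx !col_mxEu !col_mxEd !reE !imE.
(* The left inverse is the real part of the identity Q^-1 Q = 1. *)
exists (d + d)%N, B, (row_mx (re _ _ (invmx Q)) (- im _ _ (invmx Q))),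
  (lam / 2).
split; first by rewrite divr_gt0.
  rewrite mul_row_col mulNmx; apply/matrixP => i j.
  have := congr1 (fun M : 'M[R[i]]_d => complex.Re (M i j)) (mulVmx Qu).
  rewrite !mxE Re_sum => E.
  rewrite -sumrB.
  transitivity (\sum_k complex.Re (invmx Q i k * Q k j)).
    by apply: eq_bigr => k _; rewrite !mxE ReM.
  by rewrite E; case: eqP.
move=> x; rewrite !BE.
have -> : toC (H *m x) = A *m toC x by rewrite /toC map_mxM.
rewrite [Q *m (A *m _)]mulmxA -LQ -mulmxA.
apply: le_trans (trig_coercive (Q *m toC x) (ltW h0) L'trig L'diag L'off).
rewrite ler_wpM2r ?sumr_ge0// => [i _|]; first exact: cdot_ge0.
have -> : h * d%:R = lam / 2 by rewrite /h; field; rewrite gt_eqF.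
lra.
Qed.

End lyapunov.

(** * Norm equivalence, limits and conditional expectations *)

Section matrix_bounds.
Context {R : realType}.

Lemma cvg_mx_entriesP p q (u : nat -> 'M[R]_(p, q)) (l : 'M[R]_(p, q)) :
  u n @[n --> \oo] --> l <->
  forall e : R, 0 < e -> exists N, forall n, (N <= n)%N ->
    forall i j, `|l i j - u n i j| < e.
Proof.
split => [/cvg_ballP ul e e0|ul].
  have [N _ uN] := ul _ e0.
  by exists N => n Nn i j; have [_] := uN n Nn; apply.
apply/cvg_ballP => e e0; have [N uN] := ul _ e0.
by exists N => // n Nn; split => // i j; exact: uN.
Qed.

Definition mx_sum p q (M : 'M[R]_(p, q)) : R := \sum_i \sum_j `|M i j|.

Lemma mx_sum_ge0 p q (M : 'M[R]_(p, q)) : 0 <= mx_sum M.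
Proof. by do 2!apply: sumr_ge0 => ? _. Qed.

Lemma enorm_le_sum p (x : 'cV[R]_p) : enorm x <= \sum_i `|x i 0|.
Proof.
have S0 : 0 <= \sum_i `|x i 0| by exact: sumr_ge0.
rewrite -[leRHS]ger0_norm// -sqrtr_sqr ler_sqrt ?sqr_ge0//.
rewrite expr2 {1}/edot mulr_suml; apply: ler_sum => i _.
rewrite -expr2 -real_normK ?num_real// expr2 ler_wpM2l//.
by rewrite (bigD1 i)//= lerDl; exact: sumr_ge0.
Qed.

Lemma enorm_mulmx_le p q (M : 'M[R]_(p, q)) (x : 'cV[R]_q) :
  enorm (M *m x) <= mx_sum M * enorm x.
Proof.
apply: le_trans (enorm_le_sum _) _; rewrite mulr_suml; apply: ler_sum => i _.
rewrite mxE mulr_suml; apply: le_trans (ler_norm_sum _ _ _) _.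
by apply: ler_sum => j _; rewrite normrM ler_wpM2l ?coord_le_enorm.
Qed.

End matrix_bounds.

Section dot_equivalence.
Context {R : realType} {d : nat} (dot : {dot 'cV[R]_d for idfun}).
Implicit Types x y : 'cV[R]_d.

Lemma dotC x y : dot x y = dot y x.
Proof. by have := hermC dot x y; rewrite expr0 mul1r. Qed.

Lemma dotDl x y z : dot (x + y) z = dot x z + dot y z.
Proof. exact: linearDl. Qed.

Lemma dotZl t x y : dot (t *: x) y = t * dot x y.
Proof. exact: (linearZl_LR dot). Qed.

Lemma dot0l x : dot 0 x = 0.
Proof. by have := dotZl 0 0 x; rewrite scale0r mul0r. Qed.

Lemma dot_ge0 x : 0 <= dot x x.
Proof.
by have [->|x0] := eqVneq x 0; [rewrite dot0l|exact/ltW/neq0_dnorm_gt0].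
Qed.

Lemma dot_norm_ge0 x : 0 <= dot_norm dot x.
Proof. exact: sqrtr_ge0. Qed.

Lemma sqr_dot_norm x : dot_norm dot x ^+ 2 = dot x x.
Proof. by rewrite sqr_sqrtr ?dot_ge0. Qed.

Lemma dot_le x y : dot x y <= dot_norm dot x * dot_norm dot y.
Proof.
rewrite -sqrtrM ?dot_ge0//; apply: le_trans (ler_norm _) _.
rewrite -sqrtr_sqr ler_sqrt ?mulr_ge0 ?dot_ge0//.
exact: psd_cauchy_schwarz dotC dotDl dotZl dot_ge0 x y.
Qed.

Let ev (i : 'I_d) : 'cV[R]_d := delta_mx i 0.

Lemma dot_sum x y : dot x y = \sum_i x i 0 * dot (ev i) y.
Proof.
rewrite {1}(_ : x = \sum_i x i 0 *: ev i).
  rewrite (big_morph (fun z => dot z y) (id1 := 0) (op1 := +%R)).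
  - by apply: eq_bigr => i _; rewrite dotZl.
  - by move=> u v; rewrite dotDl.
  - by rewrite dot0l.
by rewrite {1}(matrix_sum_delta x); apply: eq_bigr => i _; rewrite big_ord1.
Qed.

Lemma dot_norm_le_enorm : exists2 k : R, 0 < k &
  forall x, dot_norm dot x <= k * enorm x.
Proof.
exists (1 + \sum_i dot_norm dot (ev i)).
  by rewrite ltr_wpDr// sumr_ge0// => i _; exact: dot_norm_ge0.
move=> x; have D0 := dot_norm_ge0 x; have e0 := enorm_ge0 x.
have S0 : 0 <= \sum_i dot_norm dot (ev i).
  by rewrite sumr_ge0// => i _; exact: dot_norm_ge0.
have : dot_norm dot x ^+ 2 <= (\sum_i dot_norm dot (ev i)) * enorm x * dot_norm
  dot x.
  rewrite sqr_dot_norm dot_sum !mulr_suml; apply: ler_sum => i _.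
  apply: le_trans (_ : `|x i 0| * (dot_norm dot (ev i) * dot_norm dot x) <= _).
    apply: le_trans (ler_norm _) _; rewrite normrM ler_wpM2l//.
    have h1 := dot_le (ev i) x; have h2 := dot_le (- ev i) x.
    have dN : dot (- ev i) x = - dot (ev i) x by rewrite -scaleN1r dotZl mulN1r.
    have dNN : dot_norm dot (- ev i) = dot_norm dot (ev i).
      by rewrite /dot_norm -scaleN1r dotZl dotC dotZl !mulN1r opprK.
    by rewrite dN dNN in h2; rewrite ler_norml; apply/andP; split; lra.
  rewrite mulrC mulrAC ler_wpM2r// ler_wpM2l ?dot_norm_ge0//.
  exact: coord_le_enorm.
move=> h; have [D1|D1] := ltP 0 (dot_norm dot x); last first.
  by apply: le_trans D1 _; rewrite mulr_ge0//; lra.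
have : dot_norm dot x <= (\sum_i dot_norm dot (ev i)) * enorm x.
  by rewrite -(ler_pM2r D1) -expr2.
lra.
Qed.

(* The Gram matrix of the standard basis is invertible, hence every coordinate
   is the product with a fixed vector. *)
Lemma enorm_le_dot_norm : exists2 k : R, 0 < k &
  forall x, enorm x <= k * dot_norm dot x.
Proof.
pose S : 'M[R]_d := \matrix_(i, j) dot (ev i) (ev j).
have dotS x y : dot x y = (x^T *m S *m y) 0 0.
  rewrite dot_sum -mulmxA mxE; apply: eq_bigr => i _; rewrite !mxE;
    congr (_ * _).
  rewrite dotC dot_sum; apply: eq_bigr => j _.
  by rewrite mxE mulrC dotC.
have Su : S \in unitmx.
  rewrite -row_free_unit -kermx_eq0; apply/rowV0P => v /sub_kermxP vS.
  apply/eqP; apply: contraT => v0.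
  have vT0 : v^T != 0 by rewrite -trmx0 (inj_eq trmx_inj).
  by have := neq0_dnorm_gt0 (s := dot) _ vT0;
    rewrite dotS trmxK vS mul0mx mxE ltxx.
pose w i : 'cV[R]_d := (row i (invmx S))^T.
have wE i x : x i 0 = dot (w i) x.
  by rewrite dotS trmxK -row_mul mulVmx// -row_mul mul1mx mxE.
exists (1 + \sum_i dot_norm dot (w i)).
  by rewrite ltr_wpDr// sumr_ge0// => i _; exact: dot_norm_ge0.
move=> x; rewrite mulrDl mul1r; apply: le_trans (enorm_le_sum x) _.
apply: le_trans (_ : (\sum_i dot_norm dot (w i)) * dot_norm dot x <= _);
  last first.
  by rewrite lerDr dot_norm_ge0.
rewrite mulr_suml; apply: ler_sum => i _; rewrite wE ler_norml dot_le andbT.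
have := dot_le (- w i) x.
have -> : dot (- w i) x = - dot (w i) x by rewrite -scaleN1r dotZl mulN1r.
have -> : dot_norm dot (- w i) = dot_norm dot (w i).
  by rewrite /dot_norm -scaleN1r dotZl dotC dotZl !mulN1r opprK.
lra.
Qed.

End dot_equivalence.

Section limits.
Context {R : realType}.

(** The bound is sought among the 1/(p+1), so that only countably many choices of constants and
    ranks have to be treated. The lower limit may be infinite. *)
Lemma limn_einf_gt0 (u : nat -> \bar R) : (0 < limn_einf u)%E ->
  exists p N : nat, forall n, (N <= n)%N -> (p.+1%:R^-1%:E <= u n)%E.
Proof.
rewrite limn_einf_lim => u0.
have [N uN] : exists N, (0 < einfs u N)%E.
  apply: contrapT => no; move: u0; rewrite ltNge => /negP; apply.
  apply: lime_le; first exact: is_cvg_einfs.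
  by apply: nearW => n; rewrite leNgt; apply/negP => un; apply: no; exists n.
have uE n : (N <= n)%N -> (einfs u N <= u n)%E.
  by move=> Nn; apply: ereal_inf_lbound; exists n.
move: uN uE; case: (einfs u N) => [x x0 uE|_ uE|//].
- exists (Num.truncn x^-1), N => n /uE; apply: le_trans.
  rewrite lee_fin invf_ple ?posrE//.
  exact/ltW/truncnS_gt.
- by exists 0%N, N => n /uE; rewrite leye_eq => /eqP ->; rewrite leey.
Qed.

Lemma limn_esup_lty (u : nat -> \bar R) : (forall n, (0 <= u n)%E) ->
  (limn_esup u < +oo)%E ->
  exists q N : nat, forall n, (N <= n)%N -> (u n <= q%:R%:E)%E.
Proof.
move=> u0; rewrite limn_esup_lim => uy.
have [N uN] : exists N, (esups u N < +oo)%E.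
  apply: contrapT => no; move: uy; rewrite ltNge => /negP; apply.
  apply: lime_ge; first exact: is_cvg_esups.
  by apply: nearW => n; rewrite leNgt; apply/negP => un; apply: no; exists n.
have uE n : (N <= n)%N -> (u n <= esups u N)%E.
  by move=> Nn; apply: ereal_sup_ubound; exists n.
move: uN uE; case: (esups u N) => [x _ uE|//|_ uE].
- exists (Num.truncn x).+1, N => n /uE /le_trans; apply.
  by rewrite lee_fin ltW// truncnS_gt.
- have := le_trans (u0 N) (uE _ (leqnn N)); rewrite leeNy_eq.
  by [].
Qed.

Lemma series_tail (u : nat -> R) (e : R) : (forall n,
  0 <= u n) -> cvgn (series u) ->
  0 < e -> exists N, forall N' k, (N <= N')%N -> \sum_(N' <= j < k) u j.+1 <= e.
Proof.
move=> u0 cvu e0; have /cvgrPdist_lt /(_ _ e0)[N _ uN] := cvu.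
have mono : nondecreasing_seq (series u).
  by apply/nondecreasing_seqP => n; rewrite !seriesEnat/= big_nat_recr//= lerDl.
exists N => N' k NN'; have [kN|Nk] := leqP k N'; first by rewrite big_geq// ltW.
have := uN N'.+1 (leqW NN'); have := nondecreasing_cvgn_le mono cvu k.+1.
have -> : series u k.+1 = series u N'.+1 + \sum_(N' <= j < k) u j.+1.
  rewrite !seriesEnat/= (big_cat_nat (n := N'.+1))//=; last exact: ltnW.
  by rewrite big_add1.
move=> h1 h2; have := ler_norm (limn (series u) - series u N'.+1); lra.
Qed.

End limits.

Section conditional_expectation.
Context d (T : measurableType d) (R : realType) (P : probability T R).
Variable G : set (set T).
Hypotheses (sG : sigma_algebra setT G) (GT : G `<=` measurable).

(** Integrability of [f] on [A] is a conclusion: its integral equals that of [g], which is at most k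
    P(A). *)
Lemma is_condexp_ge0_le (f : T -> R) g A (k : R) :
  measurable_fun [set: T] f -> (forall w, 0 <= f w) ->
  is_condexp_ge0 P G (EFin \o f) g -> G A ->
  (forall w, A w -> (g w <= k%:E)%E) ->
  P.-integrable A (EFin \o f) /\ \int[P]_(x in A) f x <= k * pr P A.
Proof.
move=> mf f0 [mg g0 gf] GA gk; have mA := GT GA.
have mgT := measurable_wrt_sub sG GT mg.
have h : (\int[P]_(x in A) (f x)%:E <= (k * pr P A)%:E)%E.
  rewrite -(gf _ GA) EFinM -prE// -integral_cst//.
  apply: ge0_le_integral => //.
  by apply: measurable_funS mgT.
have If : P.-integrable A (EFin \o f).
  apply/integrableP; split; first by apply/measurable_EFinP;
    exact: measurable_funS mf.
  under eq_integral => w _ do rewrite /= ger0_norm//.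
  exact: le_lt_trans h (ltry _).
split => //; rewrite /Rintegral -lee_fin fineK//.
exact: integrable_fin_num.
Qed.

Lemma is_condexp_ge0_ge (f : T -> R) g A (k : R) : 0 <= k ->
  is_condexp_ge0 P G (EFin \o f) g -> G A -> P.-integrable A (EFin \o f) ->
  (forall w, A w -> (k%:E <= g w)%E) -> k * pr P A <= \int[P]_(x in A) f x.
Proof.
move=> k0 [mg g0 gf] GA If gk; have mA := GT GA.
have mgT := measurable_wrt_sub sG GT mg.
rewrite /Rintegral -lee_fin fineK; last exact: integrable_fin_num.
rewrite -(gf _ GA) EFinM -prE// -integral_cst//.
apply: ge0_le_integral => //.
by apply: measurable_funS mgT.
Qed.

(* On [A] both f^+ and f^- have finite integrals, which agree because their
   conditional expectations do. *)
Lemma is_condexp_mean0 (f : T -> R) A : is_condexp P G f (fun=> 0) -> G A ->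
  P.-integrable A (EFin \o f) -> \int[P]_(x in A) f x = 0.
Proof.
move=> [_ [u [v [[mu u0 uf] [mv v0 vf] uv]]]] GA If; have mA := GT GA.
have muT := measurable_wrt_sub sG GT mu.
have mvT := measurable_wrt_sub sG GT mv.
have E : (\int[P]_(x in A) u x = \int[P]_(x in A) v x)%E.
  apply: ge0_ae_eq_integral => //.
  - exact: measurable_funS muT.
  - exact: measurable_funS mvT.
  - apply: filterS uv => w [fu fv e] _; move: e fu fv.
    case: (u w) => [x| |]//; case: (v w) => [y| |]// [] /esym/eqP.
    by rewrite subr_eq0 => /eqP ->.
rewrite /Rintegral integralE.
rewrite -(uf _ GA) -(vf _ GA) -E subee//.
rewrite uf//; apply: integral_fune_fin_num => //.
exact: integrable_funepos.
Qed.

End conditional_expectation.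

(** * Noise and drift in the new coordinates *)

Section truncation.
Context {R : realType} {d m : nat} (dot : {dot 'cV[R]_d for idfun}).
Variables (B : 'M[R]_(m, d)) (a k1 k2 : R).
Hypotheses (a_gt2 : 2 < a) (k1_gt0 : 0 < k1) (k2_gt0 : 0 < k2)
  (B_le : forall v, enorm (B *m v) <= k1 * dot_norm dot v)
  (le_B : forall v, dot_norm dot v <= k2 * enorm (B *m v)).

Lemma sqr_le_powR (x : R) : 0 <= x -> x ^+ 2 <= 1 + x `^ a.
Proof.
move=> x0; have a2 := a_gt2; have [x1|x1] := leP x 1.
  by apply: le_trans (_ : 1 <= _); [rewrite expr_le1|rewrite lerDl powR_ge0].
rewrite -powR_mulrn//; apply: le_trans (_ : x `^ a <= _); last lra.
by apply: ler_powR; exact: ltW.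
Qed.

(** If |B v| > K = k1 x, then |v| > x, where x^(a-2) = k1^2 / h. Hence |B v|^2 <= k1^2 |v|^2 <= h
    |v|^a, and the left side is nonpositive. This is where a > 2 is essential. *)
Lemma trunc_sqr_mulmx_ge (h : R) : 0 < h -> exists2 K, 0 <= K & forall v,
  dot_norm dot v ^+ 2 / k2 ^+ 2 - h * dot_norm dot v `^ a
    <= trunc_sqr K (B *m v).
Proof.
move=> h0; have a2 := a_gt2; have k10 := k1_gt0; have k20 := k2_gt0.
pose x := (k1 ^+ 2 / h) `^ (a - 2)^-1.
exists (k1 * x); first by rewrite mulr_ge0 ?powR_ge0// ltW.
move=> v; set D := dot_norm dot v.
have D0 : 0 <= D by exact: dot_norm_ge0.
have DB : D ^+ 2 / k2 ^+ 2 <= edot (B *m v) (B *m v).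
  rewrite ler_pdivrMr ?exprn_gt0// -sqr_enorm -exprMn mulrC.
  by apply: lerXn2r; rewrite ?nnegrE ?mulr_ge0 ?enorm_ge0 ?(ltW k20)// le_B.
rewrite /trunc_sqr; case: ifPn => [_|].
  by apply: le_trans DB; rewrite lerBlDr lerDl mulr_ge0 ?powR_ge0// ltW.
rewrite -ltNge => vK.
have xD : x < D by rewrite -(ltr_pM2l k10); exact: lt_le_trans vK (B_le v).
have x0 : 0 <= x by exact: powR_ge0.
have Dp : 0 < D by exact: le_lt_trans xD.
have Da : k1 ^+ 2 / h <= D `^ (a - 2).
  have -> : k1 ^+ 2 / h = x `^ (a - 2).
    rewrite /x -powRrM mulVf; last by rewrite subr_eq0 gt_eqF.
    by rewrite powRr1// divr_ge0 ?sqr_ge0// ltW.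
  by apply: ge0_ler_powR; rewrite ?nnegrE// ?subr_ge0 ?ltW.
have -> : D `^ a = D ^+ 2 * D `^ (a - 2).
  rewrite -powR_mulrn// -powRD; first by congr powR; ring.
  by apply/implyP => _; rewrite gt_eqF.
rewrite subr_le0; apply: le_trans DB _; rewrite -sqr_enorm.
apply: le_trans (_ : k1 ^+ 2 * D ^+ 2 <= _).
  rewrite -exprMn; apply: lerXn2r; last exact: B_le.
    exact: enorm_ge0.
  by rewrite nnegrE mulr_ge0// ltW.
rewrite [leRHS]mulrCA mulrC; apply: ler_wpM2l; first exact: sqr_ge0.
by rewrite mulrC -ler_pdivrMr.
Qed.

End truncation.

Section noise.
Context d0 (T : measurableType d0) (R : realType) (P : probability T R).
Context {d m : nat} (dot : {dot 'cV[R]_d for idfun}).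
Variables (B : 'M[R]_(m, d)) (a k1 k2 : R).
Hypotheses (a_gt2 : 2 < a) (k1_gt0 : 0 < k1) (k2_gt0 : 0 < k2)
  (B_le : forall v, enorm (B *m v) <= k1 * dot_norm dot v)
  (le_B : forall v, dot_norm dot v <= k2 * enorm (B *m v)).

Lemma measurable_dot_norm (y : T -> 'cV[R]_d) : vmeasurable y ->
  measurable_fun [set: T] (fun w => dot_norm dot (y w)).
Proof.
move=> my; apply: measurable_sqrt.
under eq_fun => w.
  rewrite dot_sum; under eq_bigr do rewrite dotC dot_sum; over.
apply: measurable_sum => i; apply: measurable_funM => //.
by apply: measurable_sum => j; exact: measurable_funM.
Qed.

Lemma noise_on_mulmx (G : set (set T)) (A : set T) (eps : T -> 'cV[R]_d)
    (V2 Va : T -> \bar R) (b c K : R) :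
  sigma_algebra setT G -> G `<=` measurable -> G A -> vmeasurable eps ->
  mx_is_condexp P G eps (fun=> 0) ->
  is_condexp_ge0 P G (fun w => (dot_norm dot (eps w) ^+ 2)%:E) V2 ->
  is_condexp_ge0 P G (fun w => (dot_norm dot (eps w) `^ a)%:E) Va ->
  0 < b -> 0 <= c ->
  (forall w, A w -> (b%:E <= V2 w)%E) -> (forall w, A w -> (Va w <= c%:E)%E) ->
  (forall v, dot_norm dot v ^+ 2 / k2 ^+ 2
     - b / (2 * k2 ^+ 2 * (1 + c)) * dot_norm dot v `^ a
    <= trunc_sqr K (B *m v)) ->
  noise_on P G A (fun w => B *m eps w) (b / (2 * k2 ^+ 2))
    (k1 ^+ 2 * (1 + c)) K.
Proof.
move=> sG GT GA meps mean V2P VaP b0 c0 V2b Vac trunc.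
have k10 := k1_gt0; have k20 := k2_gt0.
have mA := GT _ GA.
have mB : vmeasurable (fun w => B *m eps w) by exact: vmeasurable_mulmx.
have mD := measurable_dot_norm meps.
have mDa : measurable_fun [set: T] (fun w => dot_norm dot (eps w) `^ a).
  exact: measurableT_comp (measurable_powR a) mD.
have D0 w : 0 <= dot_norm dot (eps w) by exact: dot_norm_ge0.
have Da0 w : 0 <= dot_norm dot (eps w) `^ a by exact: powR_ge0.
have Da D : G D -> D `<=` A ->
    P.-integrable D (EFin \o (fun w => dot_norm dot (eps w) `^ a)) /\
    \int[P]_(x in D) dot_norm dot (eps x) `^ a <= c * pr P D.
  by move=> GD DA; apply: is_condexp_ge0_le VaP _ _ => // w /DA; exact: Vac.
have I1 D : G D -> D `<=` A ->
    P.-integrable D (EFin \o (fun w => 1 + dot_norm dot (eps w) `^ a)).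
  move=> GD DA; have [ID _] := Da _ GD DA.
  exact: (integrableD (GT _ GD) (finite_measure_integrable_cst P 1 (GT _ GD))
    ID).
have I2 D : G D -> D `<=` A ->
    P.-integrable D (EFin \o (fun w => dot_norm dot (eps w) ^+ 2)).
  move=> GD DA; apply: integrable_le (GT _ GD) _ _ (I1 _ GD DA).
    exact: measurable_funX.
  by move=> w _; rewrite ger0_norm ?sqr_ge0//; exact: sqr_le_powR.
have E2 w : edot (B *m eps w) (B *m eps w) <= k1 ^+ 2 * (dot_norm dot (eps w)
  ^+ 2).
  rewrite -sqr_enorm -exprMn; apply: lerXn2r; last exact: B_le.
    exact: enorm_ge0.
  by rewrite nnegrE mulr_ge0// ltW.
have IE D : G D -> D `<=` A ->
    P.-integrable D (EFin \o (fun w => edot (B *m eps w) (B *m eps w))).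
  move=> GD DA; apply: integrable_le (GT _ GD) _ _
    (integrableZl (GT _ GD) (k1 ^+ 2) (I2 _ GD DA)).
    exact: measurable_edot.
  by move=> w _; rewrite ger0_norm ?edot_ge0//; exact: E2.
split => //.
- exact: IE.
- move=> i D GD DA; have mD' := GT _ GD.
  have [k k0 kP] := enorm_le_dot_norm dot.
  have Ij j : P.-integrable D (EFin \o (fun w => eps w j 0)).
    apply: integrable_le mD' _ _ (integrableZl mD' (2 * k) (I1 _ GD DA)).
      exact: meps.
    move=> w _; apply: le_trans (coord_le_enorm _ _) _.
    apply: le_trans (kP _) _.
    rewrite -[leRHS]/(2 * k * (1 + dot_norm dot (eps w) `^ a)).
    rewrite [2 * k]mulrC -mulrA ler_pM2l//.
    by have := sqr_le_powR a_gt2 (D0 w); have := D0 w; have := Da0 w; nra.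
  under eq_Rintegral do rewrite mxE.
  have Ij' j : P.-integrable D (EFin \o (fun w => B i j * eps w j 0)).
    exact: (integrableZl mD' (B i j) (Ij j)).
  have [_ ->] := Rintegral_sum (index_enum _) mD' Ij'.
  apply: big1 => j _; rewrite RintegralZl//.
  have mean0 : is_condexp P G (fun w => eps w j 0) (fun=> 0).
    have z : (fun _ : T => (0 : 'cV[R]_d) j 0) = fun=> 0.
      by apply/funext => w; rewrite mxE.
    by rewrite -z; exact: mean.
  by rewrite (is_condexp_mean0 sG GT mean0 GD (Ij j)) mulr0.
- move=> D GD DA; have mD' := GT _ GD; have [ID IDc] := Da _ GD DA.
  apply: le_trans (_ : \int[P]_(x in D) (k1 ^+ 2 * (1 + dot_norm dot (eps x) `^
    a))
      <= _).
    apply: le_Rintegral => //; first exact: IE.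
      exact: (integrableZl mD' (k1 ^+ 2) (I1 _ GD DA)).
    move=> w _; apply: le_trans (E2 w) _; rewrite ler_wpM2l ?sqr_ge0//.
    exact: sqr_le_powR.
  rewrite RintegralZl//; last exact: I1.
  rewrite RintegralD//; last exact: finite_measure_integrable_cst.
  rewrite Rintegral_pr// -mulrA ler_wpM2l ?sqr_ge0// mulrDl lerD2l.
  exact: IDc.
- move=> D GD DA; have mD' := GT _ GD; have [ID IDc] := Da _ GD DA.
  have low := is_condexp_ge0_ge sG GT (ltW b0) V2P GD (I2 _ GD DA)
    (fun w Dw => V2b w (DA _ Dw)).
  (* With this weight the moment of order a costs at most b / (2 k2^2), half of the lower bound b /
     k2^2. Using 1 + c keeps the denominator positive when c = 0. *)
  set h := b / (2 * k2 ^+ 2 * (1 + c)) in trunc.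
  have J1 := integrableZl mD' (k2 ^+ 2)^-1 (I2 _ GD DA).
  have J2 := integrableZl mD' h ID.
  have h0 : 0 <= h.
    by rewrite divr_ge0 ?(ltW b0)// !mulr_ge0 ?sqr_ge0//; lra.
  apply: le_trans (_ : \int[P]_(x in D) ((k2 ^+ 2)^-1 * (dot_norm dot (eps x)
    ^+ 2)
      - h * dot_norm dot (eps x) `^ a) <= _); last first.
    apply: le_Rintegral => //.
    - exact: (integrableB mD' J1 J2).
    - apply: integrable_le mD' _ _ (IE _ GD DA);
      first exact: measurable_trunc_sqr.
      by move=> w _; rewrite ger0_norm ?trunc_sqr_ge0// trunc_sqr_le.
    - by move=> w _; rewrite mulrC; exact: trunc.
  rewrite RintegralB// !RintegralZl//; last exact: I2.
  have k22 : 0 < k2 ^+ 2 by rewrite exprn_gt0.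
  have h1 : (k2 ^+ 2)^-1 * (b * pr P D) <=
      (k2 ^+ 2)^-1 * \int[P]_(x in D) dot_norm dot (eps x) ^+ 2.
    by rewrite ler_wpM2l// invr_ge0 ltW.
  have h2 : h * \int[P]_(x in D) dot_norm dot (eps x) `^ a <= h * (c * pr P D).
    by rewrite ler_wpM2l.
  have h3 : h * (c * pr P D) <= h * ((1 + c) * pr P D).
    by rewrite ler_wpM2l// ler_wpM2r ?pr_ge0//; lra.
  have h4 : h * ((1 + c) * pr P D) = b / (2 * k2 ^+ 2) * pr P D.
    by rewrite /h; field; rewrite !gt_eqF//; lra.
  have h5 : (k2 ^+ 2)^-1 * (b * pr P D) = 2 * (b / (2 * k2 ^+ 2) * pr P D).
    by field; rewrite gt_eqF.
  lra.
Qed.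

End noise.

Section expansion.
Context {R : realType} {d m : nat}.
Variables (B : 'M[R]_(m, d)) (B' : 'M[R]_(d, m)) (H : 'M[R]_d) (lam : R).
Hypotheses (lam_gt0 : 0 < lam) (BK : B' *m B = 1%:M)
  (BH : forall x : 'cV[R]_d,
    lam * edot (B *m x) (B *m x) <= edot (B *m (H *m x)) (B *m x)).

(** The square of |B (x + g M x)| is |B x|^2 plus 2g times the product of B M x and B x plus a
    square. It suffices that this product be nonnegative, which persists for [M] near [H] and is
    independent of the size of g. *)
Lemma near_expansion : exists2 e : R, 0 < e & forall M : 'M[R]_d,
  (forall i j, `|H i j - M i j| < e) -> forall (x : 'cV[R]_d) g, 0 <= g ->
  enorm (B *m x) <= enorm (B *m (x + g *: (M *m x))).
Proof.
have lam0 := lam_gt0.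
(* An entrywise error e in the matrix changes the product of B H x and B x by at most s e |B x|^2;
   with e = lam / (1 + s) this stays below lam |B x|^2. *)
pose s := mx_sum B * mx_sum B' * (d%:R * d%:R).
have s0 : 0 <= s by rewrite !mulr_ge0 ?mx_sum_ge0.
exists (lam / (1 + s)); first by rewrite divr_gt0//; lra.
move=> M HM x g g0.
have DM : mx_sum (H - M) <= d%:R * d%:R * (lam / (1 + s)).
  have -> : d%:R * d%:R * (lam / (1 + s)) =
      \sum_(i < d) \sum_(j < d) (lam / (1 + s)).
    by rewrite !sumr_const !card_ord -mulrnA -[RHS]mulr_natl natrM.
  by do 2!(apply: ler_sum => ? _); rewrite !mxE ltW.
have xB : enorm x <= mx_sum B' * enorm (B *m x).
  by rewrite -{1}[x]mul1mx -BK -mulmxA; exact: enorm_mulmx_le.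
have BM : `|edot (B *m ((H - M) *m x)) (B *m x)| <= lam * edot (B *m x) (B *m
  x).
  apply: le_trans (norm_edot_le _ _) _; rewrite -sqr_enorm expr2 mulrA.
  rewrite ler_wpM2r ?enorm_ge0//.
  apply: le_trans (enorm_mulmx_le _ _) _.
  apply: le_trans (ler_wpM2l (mx_sum_ge0 _) (enorm_mulmx_le _ _)) _.
  apply: le_trans (_ : mx_sum B * (d%:R * d%:R * (lam / (1 + s)) *
      (mx_sum B' * enorm (B *m x))) <= _).
    by rewrite ler_wpM2l ?mx_sum_ge0// ler_pM ?mx_sum_ge0 ?enorm_ge0.
  have -> : mx_sum B * (d%:R * d%:R * (lam / (1 + s)) * (mx_sum B' * enorm (B
    *m x)))
      = s / (1 + s) * (lam * enorm (B *m x)).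
    by rewrite /s; field; rewrite gt_eqF//; rewrite -/s; lra.
  rewrite -[leRHS]mul1r ler_wpM2r ?mulr_ge0 ?enorm_ge0 ?(ltW lam0)//.
  by rewrite ler_pdivrMr; lra.
have pos : 0 <= edot (B *m (M *m x)) (B *m x).
  have -> : M *m x = H *m x + - 1 *: ((H - M) *m x).
    by rewrite scaleN1r mulmxBl opprB addrC subrK.
  rewrite mulmxDr -scalemxAr edotDl edotZl.
  by have := BH x; have := ler_norm (edot (B *m ((H - M) *m x)) (B *m x)); lra.
rewrite le_enorm mulmxDr -scalemxAr edotDl !edotDr !edotZl !edotZr.
rewrite (edotC (B *m x)).
have := edot_ge0 (B *m (M *m x)); nra.
Qed.

End expansion.

(** * The exceptional events *)

Section good_event.
Context dT (T : measurableType dT) (R : realType) (m : nat).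
Variables (F : nat -> set (set T)) (c : nat -> R) (X Y e r : nat -> T ->
  'cV[R]_m)
  (V2 Va : nat -> T -> \bar R) (b q h : R) (N : nat).

(* Index [0] is junk since [0.-1 = 0]; [good_event k] is only used for
   [k >= 1]. *)
Definition good_event k : set T := [set w |
  [/\ enorm (X k w - (Y k.-1 w + c k *: (e k w + r k w))) <= 0,
      enorm (X k w) <= enorm (Y k w),
      (b%:E <= V2 k w)%E, (Va k w <= q%:E)%E
    & \sum_(N <= j < k) enorm (r j.+1 w) ^+ 2 <= h]].

Lemma good_event_F k : filtration F -> adapted F X -> adapted F Y ->
  adapted F e -> adapted F r -> (forall n, measurable_wrt (F n) (V2 n)) ->
  (forall n, measurable_wrt (F n) (Va n)) -> F k (good_event k).
Proof.
move=> [sF mF leF] aX aY ae ar mV2 mVa.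
pose U n := g_sigma_algebraType (F n).
have up (Z : nat -> T -> 'cV[R]_m) : adapted F Z -> forall n l, (n <= l)%N ->
    vmeasurable (Z n : U l -> 'cV[R]_m).
  move=> aZ n l nl i _ D mD; rewrite setTI.
  rewrite (measurable_wrtE (sF l)); apply: leF nl _ _.
  exact: sub_preimage (aZ n i 0) mD.
have F_le (f g : T -> R) : measurable_fun [set: U k] (f : U k -> R) ->
    measurable_fun [set: U k] (g : U k -> R) -> F k [set w | f w <= g w].
  move=> mf mg; rewrite -(measurable_wrtE (sF k)).
  by rewrite -[X in measurable X]setTI;
    exact: (measurable_fun_le measurableT mf mg).
rewrite (_ : good_event k =
  [set w | enorm (X k w - (Y k.-1 w + c k *: (e k w + r k w))) <= 0] `&`
  [set w | enorm (X k w) <= enorm (Y k w)] `&`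
  V2 k @^-1` [set` `[b%:E, +oo[] `&`
  Va k @^-1` [set` `]-oo, q%:E]] `&`
  [set w | \sum_(N <= j < k) enorm (r j.+1 w) ^+ 2 <= h]); last first.
  apply/seteqP; split => w /=; rewrite !in_itv/= ?andbT.
    by move=> [].
  by move=> [[[[]]]].
have vN (z : T -> 'cV[R]_m) : vmeasurable (z : U k -> 'cV[R]_m) ->
    vmeasurable ((fun w => - z w) : U k -> 'cV[R]_m).
  move=> mz; under eq_fun do rewrite -scaleN1r; exact: vmeasurableZ.
do !apply: (sub_setI (sF k)).
- apply: F_le => //; apply: measurable_enorm; apply: vmeasurableD.
    exact: up.
  apply: vN; apply: vmeasurableD; first by apply: up => //; exact: leq_pred.
  by apply: vmeasurableZ => //; apply: vmeasurableD; exact: up.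
- by apply: F_le; apply: measurable_enorm; exact: up.
- by apply: (sub_preimage (sF k) (mV2 k)); exact: emeasurable_itv.
- by apply: (sub_preimage (sF k) (mVa k)); exact: emeasurable_itv.
- apply: F_le => //.
  have : forall l, (l <= k)%N -> measurable_fun [set: U k]
      ((fun w => \sum_(N <= j < l) enorm (r j.+1 w) ^+ 2) : U k -> R).
    elim=> [|l IH] lk; first by under eq_fun do rewrite big_geq//;
      exact: measurable_cst.
    have [Nl|lN] := leqP N l; last by under eq_fun do rewrite big_geq//;
      exact: measurable_cst.
    under eq_fun do rewrite big_nat_recr//=.
    apply: measurable_funD; first exact: (IH (ltnW lk)).
    by apply: measurable_funX; apply: measurable_enorm; exact: up.
  exact.
Qed.

End good_event.

(* [V2 n] and [Va n] are versions of E[|eps_(n+1)|^2 | F_n] and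
   E[|eps_(n+1)|^a | F_n]; the shift by one does not affect the inferior and
   superior limits. *)
Theorem corollary2p2p3
  (R : realType) (disp : measure_display) (T : measurableType disp)
  (P : probability T R) (d : nat) (dot : {dot 'cV[R]_d for idfun})
  (F : nat -> set (set T)) (gam c : nat -> R)
  (X G eps r : nat -> T -> 'cV[R]_d)
  (Hn : nat -> T -> 'M[R]_d) (H : 'M[R]_d)
  (Gamma : set T) (a : R) (T0 : {RV P >-> R})
  (V2 Va : nat -> T -> \bar R) :
  filtration F ->
  (forall n, 0 <= gam n) ->
  (forall n, 0 <= c n) ->
  (forall N, exists n, (N <= n)%N /\ c n != 0) ->
  cvgn [series c n ^+ 2]_n ->
  adapted F X -> adapted F G -> adapted F eps -> adapted F r ->
  adapted F Hn ->
  (forall n, mx_is_condexp P (F n) (eps n.+1) (fun=> 0)) ->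
  (forall n, is_condexp_ge0 P (F n)
     (fun w => (dot_norm dot (eps n.+1 w) ^+ 2)%:E) (V2 n)) ->
  (forall n, is_condexp_ge0 P (F n)
     (fun w => (dot_norm dot (eps n.+1 w) `^ a)%:E) (Va n)) ->
  (forall n, {ae P, forall w, (V2 n w < +oo)%E}) ->
  (forall n, {ae P, forall w, X n.+1 w - X n w =
     gam n.+1 *: G n w + c n.+1 *: (eps n.+1 w + r n.+1 w)}) ->
  measurable Gamma ->
  repulsive H ->
  2 < a ->
  {ae P, forall w, Gamma w -> forall n : nat, T0 w <= n%:R ->
     G n w = Hn n w *m X n w} ->
  {ae P, forall w, Gamma w -> Hn n w @[n --> \oo] --> H} ->
  {ae P, forall w, Gamma w ->
     [/\ (0 < limn_einf (fun n => V2 n w))%E,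
         (limn_esup (fun n => Va n w) < +oo)%E
       & cvgn [series dot_norm dot (r n w) ^+ 2]_n]} ->
  P (Gamma `&` [set w | X n w @[n --> \oo] --> (0 : 'cV[R]_d)]) = 0%E.

Proof.
move=> FF gam0 c0 c_io c_cvg aX aG aeps ar aH mean V2P VaP _ rec mGam Hrep a2
  GH Hcv lims.
have [sF mF leF] := FF.
have [m [B [B' [lam [lam0 BK BH]]]]] := lyapunov Hrep.
have [e0 e00 HM] := near_expansion lam0 BK BH.
have [kd kd0 kdP] := enorm_le_dot_norm dot.
have [ke ke0 keP] := dot_norm_le_enorm dot.
pose k1 := (1 + mx_sum B) * kd; pose k2 := ke * (1 + mx_sum B').
have sB := mx_sum_ge0 B; have sB' := mx_sum_ge0 B'.
have k10 : 0 < k1 by rewrite mulr_gt0//; lra.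
have k20 : 0 < k2 by rewrite mulr_gt0//; lra.
have B_le v : enorm (B *m v) <= k1 * dot_norm dot v.
  apply: le_trans (enorm_mulmx_le _ _) _; rewrite -mulrA.
  apply: ler_pM => //; [exact: enorm_ge0|lra].
have le_B v : dot_norm dot v <= k2 * enorm (B *m v).
  apply: le_trans (keP v) _; rewrite -mulrA ler_pM2l//.
  rewrite -{1}[v]mul1mx -BK -mulmxA; apply: le_trans (enorm_mulmx_le _ _) _.
  by apply: ler_wpM2r; [exact: enorm_ge0|lra].
(* The conditional bounds depend on the sample point, so they are drawn from a countable family: one
   null event for each pair and each starting rank. *)
pose b (pq : nat * nat) : R := pq.1.+1%:R^-1.
pose q (pq : nat * nat) : R := pq.2%:R.
have b0 pq : 0 < b pq by rewrite invr_gt0.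
have q0 pq : 0 <= q pq by rewrite ler0n.
have /choice[K KP] (pq : nat * nat) : exists K, 0 <= K /\ forall v,
    dot_norm dot v ^+ 2 / k2 ^+ 2
      - b pq / (2 * k2 ^+ 2 * (1 + q pq)) * dot_norm dot v `^ a
    <= trunc_sqr K (B *m v).
  have h0 : 0 < b pq / (2 * k2 ^+ 2 * (1 + q pq)).
    by rewrite divr_gt0// !mulr_gt0// ?exprn_gt0//; have := q0 pq; lra.
  by have [K0 K00 K0P] := trunc_sqr_mulmx_ge a2 k10 k20 B_le le_B h0; exists K0.
pose X' n w := B *m X n w.
pose Y' n w := B *m (X n w + gam n.+1 *: G n w).
pose e' n w := B *m eps n w.
pose r' n w := B *m r n w.
pose sl pq := slack (b pq / (2 * k2 ^+ 2)) (K pq).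
pose good pq N := good_event c X' Y' e' r' V2 Va (b pq) (q pq) (sl pq ^+ 2) N.
have vmx k (Z : T -> 'cV[R]_d) : mx_measurable_wrt (F k) Z ->
    mx_measurable_wrt (F k) (fun w => B *m Z w).
  move=> mZ i j; rewrite (ord1 j).
  by apply: (@vmeasurable_mulmx _ _ _ (g_sigma_algebraType (F k))) => i';
    exact: mZ.
have aX' : adapted F X' by move=> k; exact: vmx.
have aY' : adapted F Y'.
  move=> k; apply: vmx => i j; rewrite (ord1 j).
  apply: (@vmeasurableD _ _ _ (g_sigma_algebraType (F k))) => [i'|];
    first exact: aX.
  by apply: vmeasurableZ => // i'; exact: aG.
have ae' : adapted F e' by move=> k; exact: vmx.
have ar' : adapted F r' by move=> k; exact: vmx.
have vT k n (Z : T -> 'cV[R]_n) : mx_measurable_wrt (F k) Z -> vmeasurable Z.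
  by move=> mZ i; exact: (measurable_wrt_sub (sF k) (@mF k) (mZ i 0)).
have goodF pq N k : F k (good pq N k).
  have mV2 n : measurable_wrt (F n) (V2 n) by case: (V2P n).
  have mVa n : measurable_wrt (F n) (Va n) by case: (VaP n).
  exact: good_event_F FF aX' aY' ae' ar' mV2 mVa.
have b20 pq : 0 < b pq / (2 * k2 ^+ 2) by rewrite divr_gt0// mulr_gt0//
  exprn_gt0.
(* The rank is [N.+1] so that every index k involved is positive and [k.-1] is a genuine
   predecessor. *)
have null pq N : P.-negligible (trapped X' (good pq N.+1) N.+1).
  have gF k : (N.+1 <= k)%N -> F k (good pq N.+1 k) by move=> _; exact: goodF.
  have [mt _] := approximable_trapped P FF aX' gF.
  apply/negligibleP => //; apply: etrans (prE P mt) _; congr EFin.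
  have [K0 K0P] := KP pq.
  apply: (pr_trapped FF c0 c_io c_cvg aX' aY' (r := r') (e := e') _ (b20 pq)
    (C := k1 ^+ 2 * (1 + q pq)) _ K0 gF).
  - by move=> k; exact: vT.
  - by rewrite mulr_ge0 ?sqr_ge0//; have := q0 pq; lra.
  (* The recursion is encoded in [good_event] as a norm at most 0, which fits a measurability
     argument by inequalities; here it becomes an equality again. *)
  - move=> k w _ [h _ _ _ _]; apply/eqP; rewrite -subr_eq0; apply/eqP.
    apply/matrixP => i j; rewrite (ord1 j) [RHS]mxE; apply/normr0_eq0/le_anti.
    by rewrite normr_ge0 andbT; exact: le_trans (coord_le_enorm _ _) h.
  - by move=> k w _ [].
  - by move=> k w _ [].
  - move=> k _; apply: (noise_on_mulmx a2 k10 k20 B_le (sF k) (@mF k) (goodF _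
    _ k)
      (vT _ _ _ (aeps k.+1)) (mean k) (V2P k) (VaP k)) => //.
    + by move=> w [].
    + by move=> w [].
have null_all : {ae P, forall w, forall p l N,
    ~ trapped X' (good (p, l) N.+1) N.+1 w}.
  apply/ae_foralln => p; apply/ae_foralln => l; apply/ae_foralln => N.
  by rewrite /prop_near1 /=;
    apply: negligibleS (null (p, l) N) => w /= /contrapT.
have rec_all : {ae P, forall w, forall n, X n.+1 w - X n w =
    gam n.+1 *: G n w + c n.+1 *: (eps n.+1 w + r n.+1 w)}.
  exact/ae_foralln.
have escape : {ae P, forall w,
  ~ (Gamma w /\ X n w @[n --> \oo] --> (0 : 'cV[R]_d))}.
  near=> w => -[Gw Xw].
  have null_w : forall p l N, ~ trapped X' (good (p, l) N.+1) N.+1 w by near: w.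
  have rec_w : forall n, X n.+1 w - X n w =
    gam n.+1 *: G n w + c n.+1 *: (eps n.+1 w + r n.+1 w) by near: w.
  have GH_w : Gamma w -> forall n : nat,
    T0 w <= n%:R -> G n w = Hn n w *m X n w.
    by near: w.
  have Hcv_w : Gamma w -> Hn n w @[n --> \oo] --> H by near: w.
  have lims_w : Gamma w -> [/\ (0 < limn_einf (fun n => V2 n w))%E,
      (limn_esup (fun n => Va n w) < +oo)%E
    & cvgn [series dot_norm dot (r n w) ^+ 2]_n] by near: w.
  have [/limn_einf_gt0[p [N1 V2w]] Vaw rw] := lims_w Gw.
  have [l [N2 {}Vaw]] : exists l N2 : nat, forall n, (N2 <= n)%N ->
      (Va n w <= l%:R%:E)%E.
    by apply: limn_esup_lty Vaw => n; case: (VaP n).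
  have sl0 : 0 < sl (p, l) ^+ 2.
    have [K0 _] := KP (p, l); have := b20 (p, l) => bb.
    apply: exprn_gt0; rewrite /sl /slack divr_gt0// lt_min divr_gt0//=.
    by rewrite divr_gt0// divr_gt0// mulr_gt0//; lra.
  (* The division by k1^2 anticipates |B r| <= k1 |r|: the tail of the transformed remainders is
     then at most the square of the slack. *)
  have [N3 N3P] := series_tail (fun n => sqr_ge0 (dot_norm dot (r n w))) rw
    (divr_gt0 sl0 (exprn_gt0 2 k10)).
  have /cvg_mx_entriesP /(_ _ e00)[N4 N4P] := Hcv_w Gw.
  pose N5 := (Num.truncn (T0 w)).+1.
  pose N := maxn N1 (maxn N2 (maxn N3 (maxn N4 N5))).
  have NE k : (N.+1 <= k)%N ->
      [/\ (N1 <= k)%N, (N2 <= k)%N, (N4 <= k)%N & (N5 <= k)%N].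
    move=> /ltnW; rewrite /N !geq_max.
    by move=> /andP[-> /andP[-> /andP[_ /andP[-> ->]]]].
  have N3N : (N3 <= N.+1)%N.
    by apply: leqW; rewrite /N !leq_max leqnn !orbT.
  apply: (null_w p l N); split.
    move=> k _ Nk; have [n1 n2 n4 n5] := NE k Nk.
    split.
    - case: k Nk {n1 n2 n4 n5} => // k _ /=.
      rewrite (_ : _ - _ = 0); last first.
        rewrite /X' /Y' /e' /r' -mulmxDr scalemxAr -mulmxDr -mulmxBr.
        rewrite (_ : _ - _ = 0) ?mulmx0//.
        by rewrite -addrA -rec_w addrC subrK subrr.
      by rewrite /enorm /edot big1 ?sqrtr0// => i _; rewrite mxE mul0r.
    - rewrite /X' /Y' GH_w//; first exact: (HM _ (N4P k n4)).
      by apply/ltW/(lt_le_trans (truncnS_gt _)); rewrite ler_nat.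
    - exact: V2w.
    - exact: Vaw.
    - have := N3P _ k N3N; rewrite ler_pdivlMr ?exprn_gt0// => h.
      apply: le_trans h; rewrite mulr_suml; apply: ler_sum => j _.
      rewrite mulrC -exprMn; apply: lerXn2r; last exact: B_le.
        exact: enorm_ge0.
      by rewrite nnegrE mulr_ge0 ?dot_norm_ge0// ltW.
  move=> i _.
  have i0 : 0 < i.+1%:R^-1 / (1 + mx_sum B * d%:R) :> R.
    by rewrite divr_gt0// ltr_pwDl// mulr_ge0.
  have /cvg_mx_entriesP /(_ _ i0)[n0 n0P] := Xw.
  exists n0 => // k _ nk /=; apply: le_trans (enorm_mulmx_le _ _) _.
  apply: le_trans (_ : mx_sum B * (d%:R * (i.+1%:R^-1 / (1 + mx_sum B * d%:R)))
    <= _).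
    rewrite ler_wpM2l//; apply: le_trans (enorm_le_sum _) _.
    rewrite mulr_natl -[X in _ *+ X]card_ord -sumr_const; apply: ler_sum => j _.
    by have := n0P k nk j 0; rewrite mxE sub0r normrN => /ltW.
  set x := i.+1%:R^-1; set y := mx_sum B * d%:R.
  have y0 : 0 <= y by rewrite mulr_ge0.
  have -> : mx_sum B * (d%:R * (x / (1 + y))) = x * (y / (1 + y)).
    by rewrite /y; field; rewrite gt_eqF//; rewrite -/y; lra.
  rewrite -[leRHS]mulr1; apply: ler_wpM2l; first by rewrite invr_ge0.
  by rewrite ler_pdivrMr ?mul1r; lra.
(* The conclusion is a value of [P], so negligibility is not enough: convergence to 0 is written
   with countable operations to make the event measurable. *)
have mS : measurable (Gamma `&` [set w | X n w @[n --> \oo] --> (0 :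
  'cV[R]_d)]).
  apply: measurableI => //.
  rewrite (_ : [set w | _] = \bigcap_i \bigcup_n \bigcap_k [set w | (n <= k)%N
    ->
      enorm (X k w) < i.+1%:R^-1]); last first.
    apply/seteqP; split => w /=.
      move=> Xw i _.
      have i0 : 0 < i.+1%:R^-1 / (1 + d%:R) :> R by rewrite divr_gt0// ltr_pwDl.
      have /cvg_mx_entriesP /(_ _ i0)[n0 n0P] := Xw.
      exists n0 => // k _ nk; apply: le_lt_trans (enorm_le_sum _) _.
      apply: le_lt_trans (_ : d%:R * (i.+1%:R^-1 / (1 + d%:R)) < _).
        rewrite mulr_natl -[X in _ *+ X]card_ord -sumr_const;
          apply: ler_sum => j _.
        by have := n0P k nk j 0; rewrite mxE sub0r normrN => /ltW.
      rewrite mulrCA -[ltRHS]mulr1 ltr_pM2l ?invr_gt0//.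
      by rewrite ltr_pdivrMr ?mul1r ?ltrDr// ltr_pwDl.
    move=> Xw; apply/cvg_mx_entriesP => e e_gt0.
    have [n _ nP] := Xw (Num.truncn e^-1) I.
    exists n => k nk i j; rewrite (ord1 j) mxE sub0r normrN.
    apply: le_lt_trans (coord_le_enorm _ _) _; apply: lt_trans (nP k I nk) _.
    by rewrite invf_plt ?posrE//; exact: truncnS_gt.
  apply: bigcapT_measurable => i; apply: bigcupT_measurable => n.
  apply: bigcapT_measurable => k.
  have [nk|nk] := boolP (n <= k)%N; last first.
    by rewrite (_ : [set _ | _] = setT)//; apply/seteqP; split.
  rewrite (_ : [set _ | _] = (fun w => enorm (X k w)) @^-1` [set` `]-oo,
    i.+1%:R^-1[]).
    by rewrite -[X in measurable X]setTI; apply: measurable_enorm => //;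
      exact: vT.
  by apply/seteqP; split => w /=; rewrite in_itv/=; [exact|].
apply/negligibleP => //.
by apply: negligibleS escape => w /= h; apply.
Unshelve. all: by end_near.
Qed.
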